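(* Let $m\ge 1$ and suppose $\mu$ is a friendly measure on $K_S^m$. Then $\mu(Sing_S^m)=0$.
   Context: $K$ is a totally real number field of degree $d$ over $\mathbb Q$ with ring of integers $\mathcal O_K$; $S$ is the set of its $d$ archimedean places, identified with the embeddings $\sigma:K\to\mathbb R$. For $\sigma\in S$, $K_\sigma\cong\mathbb R$ is the completion of $\sigma(K)$, and $K_S=\prod_{\sigma\in S}K_\sigma$. $K$ is embedded diagonally in $K_S$ by $\alpha\mapsto(\sigma(\alpha))_{\sigma\in S}$ and identified with its image; similarly $K^m\subset K_S^m\simeq\prod_{\sigma}K_\sigma^m$. For $x=(x^\sigma)\in K_S$, $\|x\|=\max_\sigma|x^\sigma|$; for $\mathbf x=(x_1,\dots,x_m)\in K_S^m$, $\|\mathbf x\|=\max_j\|x_j\|$. For $\mathbf q\in\mathcal O_K^m$, $\mathbf q\cdot\mathbf x=\sum_j q_jx_j\in K_S$. Singular vectors: $\mathbf x\in K_S^m$ is singular if for every $c>0$, for all sufficiently large $Q>0$ there exist $\mathbf 0\ne\mathbf q\in\mathcal O_K^m$ and $q_0\in\mathcal O_K$ with $\|\mathbf q\cdot\mathbf x+q_0\|<c/Q^m$ and $\|\mathbf q\|\le Q$. $Sing_S^m$ denotes the set of singular vectors in $K_S^m$. $D$-Federer: a Radon measure $\nu$ on a metric space $X$ is $D$-Federer on an open set $U$ with $\nu(U)>0$ if $\sup \frac{\nu(B(x,3r))}{\nu(B(x,r))}<D$, the sup being over $x\in\operatorname{supp}\nu$, $r>0$ with $B(x,3r)\subset U$.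 Nonplanar: a measure $\mu=\prod_{\sigma\in S}\mu_\sigma$ on $K_S^m$ (with $\mu_\sigma$ a measure on $K_\sigma^m$) is nonplanar if for all $\sigma\in S$, $\mu_\sigma(\mathcal L_\sigma)=0$ for every affine hyperplane $\mathcal L_\sigma$ of $K_\sigma^m\cong\mathbb R^m$. Decaying: for an affine subspace $\mathcal L\subset K_\sigma^m$ let $d_{\mathcal L}(\mathbf x)$ be the Euclidean distance from $\mathbf x$ to $\mathcal L$, and $\mathcal L(\varepsilon)=\{\mathbf x\in K_\sigma^m:d_{\mathcal L}(\mathbf x)<\varepsilon\}$. For $A\subset K_\sigma^m$ with $\mu_\sigma(A)>0$ and a function $f$, put $\|f\|_{\mu_\sigma,A}=\sup_{\mathbf x\in A\cap\operatorname{supp}\mu_\sigma}|f(\mathbf x)|$. Given $C,\alpha>0$ and an open $U_\sigma\subset K_\sigma^m$, $\mu_\sigma$ is $(C,\alpha)$-decaying on $U_\sigma$ if for any nonempty open ball $B\subset U_\sigma$ centered in $\operatorname{supp}\mu_\sigma$, any affine hyperplane $\mathcal L\subset K_\sigma^m$ and any $\varepsilon>0$, $\mu_\sigma(B\cap\mathcal L(\varepsilon))\le C\left(\frac{\varepsilon}{\|d_{\mathcal L}\|_{\mu_\sigma,B}}\right)^\alpha\mu_\sigma(B)$. Friendly: a measure $\mu=\prod_\sigma\mu_\sigma$ on $K_S^m$ is friendly if $\mu$ is nonplanar and for every $\sigma\in S$, for $\mu_\sigma$-a.e. $\mathbf x^\sigma\in K_\sigma^m$, there exist a neighbourhood $U_\sigma$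 of $\mathbf x^\sigma$ and positive $C_\sigma,\alpha_\sigma,D>0$ such that $\mu_\sigma$ is $D$-Federer and $(C_\sigma,\alpha_\sigma)$-decaying on $U_\sigma$. *)

(* Defs.v *)
From HB Require Import structures.
From mathcomp Require Import all_boot all_order all_algebra all_field.
From mathcomp Require Import complex.
From mathcomp Require Import all_classical all_reals all_analysis.

Set Implicit Arguments.
Unset Strict Implicit.
Unset Printing Implicit Defensive.

Import Order.TTheory GRing.Theory Num.Theory.
Import numFieldNormedType.Exports.

Local Open Scope classical_set_scope.
Local Open Scope ring_scope.

(* The set S of archimedean places is indexed by 'I_d
   through a family sigma of embeddings K -> R.  K_S^m is 'M[R]_(d, m): row i is
   the component in K_(sigma i)^m = 'rV[R]_m, column j is the j-th coordinate in
   K_S, and the library norm of a matrix is the maximum of the absolute values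
   of its entries, that is, max_j max_sigma |x_j^sigma|. *)

Definition totally_real (R : realType) (K : fieldExtType rat) : Prop :=
  forall (f : {rmorphism K -> R[i]}) (a : K), complex.Im (f a) = 0.

(* Equality of embeddings is pointwise (=1): a {rmorphism _ -> _} also carries
   proofs. *)
Definition archimedean_places (R : realType) (K : fieldExtType rat) (d : nat)
    (sigma : 'I_d -> {rmorphism K -> R}) : Prop :=
  (forall i j, sigma i =1 sigma j -> i = j) /\
  (forall f : {rmorphism K -> R}, exists i, f =1 sigma i).

Definition ringOfIntegers (K : fieldExtType rat) : set K :=
  [set a | integralOver (intr : int -> K) a].

Section KS.
Context (R : realType) (K : fieldExtType rat) (d : nat).
Variable sigma : 'I_d -> {rmorphism K -> R}.

(* The diagonal embedding of K^m in K_S^m; K itself is the case m = 1. *)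
Definition diag_embed (m : nat) (q : 'rV[K]_m) : 'M[R]_(d, m) :=
  \matrix_(i < d, j < m) sigma i (q ord0 j).

(* q . x = sum_j q_j x_j, computed componentwise in the ring K_S = 'cV[R]_d. *)
Definition dotKS (m : nat) (q : 'rV[K]_m) (x : 'M[R]_(d, m)) : 'cV[R]_d :=
  \col_(i < d) \sum_(j < m) sigma i (q ord0 j) * x i j.

Definition singular (m : nat) (x : 'M[R]_(d, m)) : Prop :=
  forall c : R, 0 < c ->
  \forall Q \near +oo,
    exists (q : 'rV[K]_m) (q0 : K),
      [/\ q != 0,
          forall j, ringOfIntegers (q ord0 j),
          ringOfIntegers q0,
          `|dotKS q x + diag_embed (\row_(_ < 1) q0)| < c / Q ^+ m
        & `|diag_embed q| <= Q].

Definition Sing (m : nat) : set 'M[R]_(d, m) := [set x | singular x].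

End KS.

Definition borel (T : ptopologicalType) := g_sigma_algebraType (@open T).

Section Measures.
Context (R : realType).
Local Open Scope ereal_scope.

Section NormedSpace.
Context (X : normedModType R) (nu : {measure set (borel X) -> \bar R}).

Definition radon : Prop :=
  (forall A : set X, compact A -> nu A < +oo) /\
  (forall A : set (borel X), measurable A ->
     nu A = ereal_sup [set nu B | B in [set B : set X | compact B /\ B `<=` A]]).

Definition msupport : set X :=
  [set x | forall U : set X, open_nbhs x U -> 0 < nu U].

Definition federer (D : R) (U : set X) : Prop :=
  [/\ open U, 0 < nu U &
      ereal_sup [set t | exists (x : X) (r : R),
                   [/\ msupport x, (0 < r)%R, ball x (3 * r)%R `<=` U
                     & t = nu (ball x (3 * r)%R) / nu (ball x r)]]
      < D%:E].

End NormedSpace.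

Section RealVectors.
Context (m : nat).

Definition affine_hyperplane (L : set 'rV[R]_m) : Prop :=
  exists (a : 'rV[R]_m) (b : R),
    a != 0%R /\ L = [set x | (\sum_(j < m) a ord0 j * x ord0 j)%R = b].

(* `|x - y| and ball on 'rV[R]_m refer to the max norm; only the distance to a
   hyperplane is Euclidean.  (Euclidean balls in federer and decaying would
   yield the same friendly measures, after shrinking U and enlarging C, D.) *)
Definition euclid_dist (L : set 'rV[R]_m) (x : 'rV[R]_m) : R :=
  inf [set Num.sqrt (\sum_(j < m) (x ord0 j - y ord0 j) ^+ 2)%R | y in L].

Definition thickening (L : set 'rV[R]_m) (e : R) : set 'rV[R]_m :=
  [set x | (euclid_dist L x < e)%R].

Variable nu : {measure set (borel 'rV[R]_m) -> \bar R}.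

Definition sup_norm_on (f : 'rV[R]_m -> R) (A : set 'rV[R]_m) : \bar R :=
  ereal_sup [set `|f x|%:E | x in A `&` msupport nu].

(* In \bar R, e%:E / 0 = +oo for 0 < e: the bound is void when d_L vanishes on
   the support inside the ball. *)
Definition decaying (C alpha : R) (U : set 'rV[R]_m) : Prop :=
  forall (x : 'rV[R]_m) (r : R), msupport nu x -> (0 < r)%R ->
    ball x r `<=` U ->
  forall L : set 'rV[R]_m, affine_hyperplane L ->
  forall e : R, (0 < e)%R ->
    nu (ball x r `&` thickening L e) <=
      C%:E * (e%:E / sup_norm_on (euclid_dist L) (ball x r)) `^ alpha
      * nu (ball x r).

End RealVectors.

Section Products.
Context (d m : nat).
Implicit Type nu : 'I_d -> {measure set (borel 'rV[R]_m) -> \bar R}.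

(* mu is the product of the nu i: for sigma-finite nu i (in particular Radon
   ones) the values on measurable rectangles determine mu. *)
Definition is_product (mu : {measure set (borel 'M[R]_(d, m)) -> \bar R}) nu :
    Prop :=
  forall A : 'I_d -> set (borel 'rV[R]_m), (forall i, measurable (A i)) ->
    mu [set x : 'M[R]_(d, m) | forall i, A i (row i x)] =
    \prod_(i < d) nu i (A i).

Definition nonplanar nu : Prop :=
  forall i (L : set 'rV[R]_m), affine_hyperplane L -> nu i L = 0.

Definition friendly (mu : {measure set (borel 'M[R]_(d, m)) -> \bar R}) :
    Prop :=
  exists nu : 'I_d -> {measure set (borel 'rV[R]_m) -> \bar R},
    [/\ forall i, radon (nu i),
        is_product mu nu,
        nonplanar nu
      & forall i, {ae nu i, forall x : 'rV[R]_m,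
          exists (U : set 'rV[R]_m) (C alpha D : R),
            [/\ open_nbhs x U,
                [/\ (0 < C)%R, (0 < alpha)%R & (0 < D)%R],
                federer (nu i) D U
              & decaying (nu i) C alpha U]}].

End Products.
End Measures.

(* Main.v *)
Require Import Defs.
From mathcomp Require Import all_boot all_order all_algebra all_field.
From mathcomp Require Import all_classical all_reals all_analysis.
From mathcomp Require Import ring lra zify.

(** Kleinbock-Margulis quantitative nondivergence, run without exterior algebra
    or finiteness of the set of small sublattices.  For Q >= 1 the map
    (q_0, q) |-> (Q^m (q_0 + q.x), q / Q) turns the inequalities defining
    singularity into the existence of a nonzero integral vector which is short at
    every place.  The covolume psi_V(x) of a K-subspace V of K^(m+1) is the
    product over the places of the largest minor of the image of an integral
    basis of V.  Each minor is an affine function of x^sigma, so the decay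
    condition makes {psi_V < eps} small on every ball where psi_V reaches a fixed
    rho; since nonzero integers have norm at least 1 and the measure is nonplanar,
    on a fixed ball every V <> 0 reaches such a rho, uniformly in Q.

    Nondivergence is an induction on intervals V_0 < V_1 of subspaces: if x has a
    short vector v in V_1 outside V_0 while psi_{V_0}(x) <= 1 and
    psi_{V_1}(x) >= eps, then psi_{V_0 + Kv}(x) is small, so some intermediate
    psi_V(x) is below rho.  At the largest scale around x where an intermediate
    psi_V stays below rho, either psi_V(x) < eps, which is rare, or x is bad for
    (V_0, V) or for (V, V_1); a Vitali covering by such balls sums up the bounds.
    Letting eps tend to 0 shows that the points having short vectors for all large
    Q form a null set. *)

Set Implicit Arguments.
Unset Strict Implicit.
Unset Printing Implicit Defensive.

Import Order.TTheory GRing.Theory Num.Theory.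
Import numFieldNormedType.Exports.

Local Open Scope classical_set_scope.
Local Open Scope ring_scope.

(** * Outer measure bounds and coverings *)

Section OuterBound.
Context d (T : measurableType d) (R : realType).
Variable mu : {measure set T -> \bar R}.
Local Open Scope ereal_scope.

(** An outer measure bound. The sets of points with short vectors are estimated through measurable
    covers, so their own measurability is never at issue. *)
Definition outer_le (A : set T) (c : \bar R) : Prop :=
  exists M, [/\ measurable M, A `<=` M & mu M <= c].

Lemma outer_leW A B a b : A `<=` B -> a <= b -> outer_le B a -> outer_le A b.
Proof.
move=> AB ab [M [mM BM Ma]]; exists M; split => //.
  exact: subset_trans BM.
exact: le_trans ab.
Qed.

Lemma outer_le_set0 c : 0 <= c -> outer_le set0 c.
Proof. by move=> c0; exists set0; split => //; rewrite measure0. Qed.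

Lemma outer_leU A B a b :
  outer_le A a -> outer_le B b -> outer_le (A `|` B) (a + b).
Proof.
move=> [M [mM AM Ma]] [N [mN BN Nb]]; exists (M `|` N); split.
- exact: measurableU.
- exact: setUSS.
- by apply: (le_trans (measureU2 mu mM mN)); exact: leeD.
Qed.

Lemma outer_le_bigcup_seq (I : eqType) (s : seq I) (F : I -> set T)
    (c : I -> \bar R) :
  (forall i, i \in s -> outer_le (F i) (c i)) ->
  outer_le [set x | exists2 i, i \in s & F i x] (\sum_(i <- s) c i).
Proof.
elim: s => [|i s IH] H.
  rewrite big_nil; apply: (outer_leW _ (lexx _) (outer_le_set0 (lexx _))).
  by move=> x /= [].
rewrite big_cons.
apply: (outer_leW _ (lexx _)
  (outer_leU (H i (mem_head _ _)) (IH _))) => [x /= [j]|j js].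
  by rewrite inE => /predU1P[->|js] Fx; [left|right; exists j].
by apply: H; rewrite inE js orbT.
Qed.

(** The tail intersections of the measurable covers increase and each has measure at most [c];
    continuity from below concludes. This turns a bound uniform in Q into a bound for the points
    with short vectors for all large Q. *)
Lemma outer_le_liminf (A : nat -> set T) c :
  (forall n, outer_le (A n) c) ->
  outer_le [set x | exists N, forall n, (N <= n)%N -> A n x] c.
Proof.
move=> /choice[M HM].
pose L N := \bigcap_(n in [set n | (N <= n)%N]) M n.
have mM n : measurable (M n) by have [] := HM n.
have mL N : measurable (L N) by apply: bigcap_measurable => // ; exists N => /=.
exists (\bigcup_N L N); split.
- exact: bigcupT_measurable.
- move=> x [N H]; exists N => // n /= Nn.
  by have [_ + _] := HM n; apply; exact: H.
- have ndL : nondecreasing_seq L.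
    move=> i j ij; apply/subsetPset => x Lx n /= jn; apply: Lx => /=.
    exact: leq_trans jn.
  have := nondecreasing_cvg_mu mL (bigcupT_measurable _ mL) ndL (mu := mu).
  move=> cv; rewrite -(cvg_lim _ cv)//.
  apply: lime_le; first by apply/cvg_ex; eexists; exact: cv.
  apply: nearW => n /=.
  have [_ _] := HM n; apply: le_trans; apply: le_measure; rewrite ?inE//.
  by move=> x; apply => /=.
Qed.

Lemma outer_le_bigcup c (A : nat -> set T) :
  (forall n m, (n <= m)%N -> A n `<=` A m) -> (forall n, outer_le (A n) c) ->
  outer_le (\bigcup_n A n) c.
Proof.
move=> ndA /outer_le_liminf; apply: outer_leW => // x [N _ ANx].
by exists N => n /ndA; exact.
Qed.

Lemma negligible_outer_le (A : set T) :
  (forall e : R, (0 < e)%R -> outer_le A e%:E) -> mu.-negligible A.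
Proof.
move=> H.
have /choice[M HM] : forall n, exists M,
    [/\ measurable M, A `<=` M & mu M <= (n.+1%:R^-1)%:E].
  by move=> n; apply: H; rewrite invr_gt0.
exists (\bigcap_n M n); split.
- by apply: bigcapT_measurable => n; have [] := HM n.
- have mI : measurable (\bigcap_n M n).
    by apply: bigcapT_measurable => n; have [] := HM n.
  apply/eqP; rewrite eq_le measure_ge0 andbT.
  apply/lee_addgt0Pr => e e0; rewrite add0e.
  have [n ne] : exists n, (n.+1%:R^-1 < e)%R.
    exists (Num.truncn e^-1).
    rewrite invf_plt ?posrE//; exact: truncnS_gt.
  apply: (@le_trans _ _ (mu (M n))).
    by apply: le_measure; rewrite ?inE//; [have [] := HM n|move=> x; exact].
  by have [_ _ /le_trans] := HM n; apply; rewrite lee_fin ltW.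
- by move=> x Ax n _; have [_ + _] := HM n; exact.
Qed.

End OuterBound.

Section MatrixBalls.
Context (R : realType) (p q : nat).
Local Notation X := 'M[R]_(p, q).

Lemma mx_ballE (x y : X) (r : R) :
  0 < r -> ball x r y <-> (forall i j, `|x i j - y i j| < r).
Proof. by move=> r0; split => [[? H] i j|H]; [apply: H|split => // i j; apply: H]. Qed.

Lemma ball_subset (x y : X) (r s t : R) :
  ball x t y -> t + s <= r -> ball y s `<=` ball x r.
Proof.
move=> xy tsr z yz; apply: (@le_ball _ _ x (t + s)) => //.
exact: ball_triangle xy yz.
Qed.

Lemma measurable_ball (x : X) (r : R) : measurable (ball x r : set (borel X)).
Proof. by apply: sub_sigma_algebra; exact: ball_open. Qed.

(** Balls with rational centre and radius 1/(n+1) form a countable base. To each of them that lies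
    in some [ball z (r z)] with [z] in [E], one such [z] is assigned, and these points suffice. *)
Lemma lindelof_balls (E : set X) (r : X -> R) :
  E !=set0 -> (forall x, E x -> 0 < r x) ->
  exists y : nat -> X, (forall n, E (y n)) /\
    E `<=` \bigcup_n ball (y n) (r (y n)).
Proof.
move=> [x0 Ex0] r0.
pose B (c : 'M[rat]_(p, q) * nat) : set X :=
  ball (map_mx (@ratr R) c.1 : X) (c.2.+1%:R^-1).
pose good c y := E y /\ B c `<=` ball y (r y).
have /choice[f Hf] : forall c, exists y, E y /\ ((exists z, good c z) -> good c y).
  move=> c; have [[z [Ez cz]]|nz] := pselect (exists z, good c z).
    by exists z; split => // _.
  by exists x0; split => // /nz.
(* Integers that encode no rational ball are sent to the default point [x0], which lies in [E]. *)
pose y n := if unpickle n is Some c then f c else x0.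
exists y; split => [n|x Ex].
  by rewrite /y; case: unpickle => [c|//]; have [] := Hf c.
have rx := r0 _ Ex.
have [n nr] : exists n, n.+1%:R^-1 < r x / 2 :> R.
  exists (Num.truncn (r x / 2)^-1).
  rewrite invf_plt ?posrE//; [exact: truncnS_gt|by rewrite divr_gt0].
have n0 : 0 < n.+1%:R^-1 :> R by rewrite invr_gt0.
move: n0 nr; set e := (X in 0 < X) => n0 nr.
have /choice[g Hg] : forall ij : 'I_p * 'I_q, exists t : rat, `|x ij.1 ij.2 - ratr t| < e.
  move=> [i j] /=.
  have /rat_in_itvoo[t] : x i j - e < x i j + e.
    by lra.
  rewrite in_itv/= => /andP[t1 t2]; exists t; rewrite ltr_norml; apply/andP; split; lra.
pose c : 'M[rat]_(p, q) * nat := (\matrix_(i, j) g (i, j), n).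
have Bcx : B c x.
  apply/mx_ballE => // i j; rewrite !mxE distrC; exact: (Hg (i, j)).
have gx : good c x.
  split => // z cz; apply: (@ball_subset x (map_mx (@ratr R) c.1) _ e e) => //.
    exact: ball_sym.
  by rewrite /= (splitr (r x)) lerD// ltW.
have [_ /(_ (ex_intro _ x gx)) [_ cy]] := Hf c.
exists (pickle c) => //; rewrite /y pickleK; exact: cy.
Qed.

End MatrixBalls.

Section FiniteVitali.
Context (R : realType) (p q : nat).
Local Notation X := 'M[R]_(p, q).
Variable mu : {measure set (borel X) -> \bar R}.

Lemma ball_center_gt0 (x z : X) (r : R) : ball x r z -> 0 < r.
Proof. by case. Qed.

(** Greedy selection: keep a ball of largest radius, drop those meeting it (its triple covers them),
    recurse. Disjointness of the kept balls is recorded only through its consequence, that their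
    measures add up to at most the measure of any measurable set containing them. *)
Lemma finite_vitali (s : seq (X * R)) :
  exists s' : seq (X * R), [/\ {subset s' <= s},
    forall i x, i \in s -> ball i.1 i.2 x ->
      exists2 j, j \in s' & ball j.1 (3 * j.2) x
  & forall W : set (borel X), measurable W ->
      (forall i, i \in s' -> ball i.1 i.2 `<=` W) ->
      (\sum_(i <- s') mu (ball i.1 i.2) <= mu W)%E].
Proof.
have [n] := ubnP (size s); elim: n s => // n IH s; rewrite ltnS => sn.
case: (pselect (exists i, i \in s)) => [[i0 si0]|ns]; last first.
  exists [::]; split => // [i x si|W mW _].
    by exfalso; apply: ns; exists i.
  by rewrite big_nil measure_ge0.
have [i [si imax]] : exists i, i \in s /\ forall j, j \in s -> j.2 <= i.2.
  elim: (s) i0 si0 => // a t IHt i0 _.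
  case: t IHt => [|b t] IHt.
    by exists a; rewrite mem_head; split => // j; rewrite inE => /eqP ->.
  have [i [si imax]] := IHt b (mem_head _ _).
  have [ai|ai] := leP a.2 i.2.
    exists i; rewrite inE si orbT; split => // j.
    by rewrite inE => /predU1P[->//|/imax].
  exists a; rewrite mem_head; split => // j.
  by rewrite inE => /predU1P[->//|/imax/le_trans]; apply; exact: ltW.
pose B (j : X * R) : set X := ball j.1 j.2.
pose s1 := [seq j <- s | `[< B i `&` B j = set0 >] & j != i].
have s1n : (size s1 < n)%N.
  apply: leq_trans sn; rewrite /s1 size_filter -(count_predC (predC1 i) s).
  apply: (@leq_ltn_trans (count (predC1 i) s)).
    by apply: sub_count => j /= /andP[].
  rewrite -[X in (X < _)%N]addn0 ltn_add2l -has_count; apply/hasP.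
  by exists i => //=; rewrite eqxx.
have [s' [s's1 cov sums]] := IH s1 s1n.
exists (i :: s'); split.
- move=> j; rewrite inE => /predU1P[->//|/s's1].
  by rewrite mem_filter => /andP[].
- move=> j x sj jx.
  have hit : B i `&` B j !=set0 -> ball i.1 (3 * i.2) x.
    move=> [z [iz jz]].
    have := imax _ sj; have ri0 := ball_center_gt0 iz => ji.
    apply: (@ball_subset _ _ _ i.1 z _ (i.2 + i.2) i.2) => //; first lra.
    apply: (@le_ball _ _ _ (j.2 + j.2)); first lra.
    by apply: ball_triangle jx; exact: ball_sym.
  have [ij|ij] := pselect (B i `&` B j !=set0).
    by exists i; [rewrite mem_head|exact: hit].
  have [k ks kx] : exists2 k, k \in s' & ball k.1 (3 * k.2) x.
    apply: (cov j x) => //; rewrite mem_filter sj andbT; apply/andP; split.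
      by apply/asboolP; apply/eqP; apply/negPn/negP => /set0P.
    by apply/eqP => ji; apply: ij; rewrite ji; exists x; rewrite ji in jx; split.
  by exists k => //; rewrite inE ks orbT.
- move=> W mW H; rewrite big_cons.
  have mB := measurable_ball i.1 i.2.
  have BW : B i `<=` W by apply: H; exact: mem_head.
  have -> : mu W = (mu (B i) + mu (W `\` B i))%E.
    rewrite -measureU//; last 2 first.
    - exact: measurableD.
    - by apply/seteqP; split => // x [? []].
    by rewrite setDUK.
  rewrite leeD2l//; apply: sums; first exact: measurableD.
  move=> j js x jx; split; first by apply: (H j) => //; rewrite inE js orbT.
  move=> ix; have := s's1 _ js; rewrite mem_filter => /andP[/andP[/asboolP e _] _].
  by have : (B i `&` B j) x by []; rewrite e.
Qed.

End FiniteVitali.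

(** * Quantitative nondivergence for an abstract ordered family of covolumes *)

Section Nondivergence.
Context (R : realType) (p q : nat).
Local Notation X := 'M[R]_(p, q).
Variables (mu : {measure set (borel X) -> \bar R}) (S U : set X) (D : R).
Hypothesis D_ge0 : 0 <= D.
Hypothesis doubling : forall y (r : R), S y -> 0 < r -> ball y (3 * r) `<=` U ->
  (mu (ball y (3 * r)) <= D%:E * mu (ball y r))%E.

(** [T] stands for the sublattices with their rank [rk], [V] for the vectors, [psi] for the covolume
    and [N] for the product of the local norms of a vector. *)
Variables (T V : Type) (ltT : T -> T -> Prop) (rk : T -> nat)
  (mem : T -> V -> Prop) (psi : T -> X -> R) (N : V -> X -> R).
Hypothesis ltT_trans : forall a b c, ltT a b -> ltT b c -> ltT a c.
Hypothesis rk_lt : forall a b, ltT a b -> (rk a < rk b)%N.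
Hypothesis N_ge0 : forall v x, 0 <= N v x.
Variable C : R.
Hypothesis C_ge0 : 0 <= C.
(** Adding [v] to [a] yields a subspace whose covolume is controlled. The first alternative is the
    case where this subspace is already [b]. *)
Hypothesis extend : forall a b v, ltT a b -> mem b v -> ~ mem a v ->
  (forall x, psi b x <= C * psi a x * N v x) \/
  exists c, [/\ ltT a c, ltT c b & forall x, psi c x <= C * psi a x * N v x].
Hypothesis psi_usc : forall a x t, psi a x < t ->
  exists2 r : R, 0 < r & forall y, ball x r y -> psi a y < t.

Variables (rho eps kappa : R).
Hypothesis rho_le1 : rho <= 1.
Hypothesis eps_rho : eps <= rho.
Hypothesis kappa_ge0 : 0 <= kappa.
Hypothesis good : forall a y (r : R), S y -> 0 < r -> ball y r `<=` U ->
  (exists z, [/\ ball y r z, S z & rho <= psi a z]) ->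
  outer_le mu (ball y r `&` [set x | psi a x < eps])
    (kappa%:E * mu (ball y r))%E.

(* The upper bound on psi a and the lower bound on psi b are imposed at the point
   x itself, so that the same set can be used on every smaller ball. *)
Definition bad (a b : T) : set X :=
  [set x | [/\ psi a x <= 1, eps <= psi b x
    & exists v, [/\ mem b v, ~ mem a v & C * N v x < eps]]].

(** In each step the interval splits in two and one set of small covolume is added, whence
    [1 + 2 * bad_const k']. Three factors [D] shrink balls of radius 27t to radius t, and a fourth
    passes from the ball of radius 3r to that of radius r. *)
Fixpoint bad_const (k : nat) : R :=
  if k is k'.+1 then D ^+ 4 * (1 + 2 * bad_const k') else 0.

Lemma bad_const_ge0 k : 0 <= bad_const k.
Proof.
by elim: k => //= k IH; rewrite mulr_ge0 ?exprn_ge0// addr_ge0// mulr_ge0.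
Qed.

Lemma bad_between a b x : ltT a b -> bad a b x ->
  exists c, [/\ ltT a c, ltT c b & psi c x < rho].
Proof.
move=> ab [ax bx [v [bv av vx]]].
have H t : t <= C * psi a x * N v x -> t < eps.
  move=> /le_lt_trans; apply; apply: le_lt_trans vx.
  by rewrite ler_wpM2r//; rewrite ler_piMr.
have [b_le|[c [ac cb c_le]]] := extend ab bv av.
  by have := H _ (b_le x); rewrite ltNge bx.
by exists c; split => //; apply: lt_le_trans eps_rho; exact: H.
Qed.

Lemma bad_split a b c x : ltT a c -> ltT c b -> bad a b x ->
  psi c x < rho -> psi c x < eps \/ bad a c x \/ bad c b x.
Proof.
move=> ac cb [ax bx [v [bv av vx]]] cx.
have [?|cx'] := ltP (psi c x) eps; [by left|right].
have [cv|cv] := pselect (mem c v).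
  by left; split => //; exists v.
right; split => //; first by apply: ltW; exact: lt_le_trans rho_le1.
by exists v.
Qed.

Lemma doubling3 y (r : R) : S y -> 0 < r -> ball y (27 * r) `<=` U ->
  (mu (ball y (27 * r)) <= (D ^+ 3)%:E * mu (ball y r))%E.
Proof.
move=> Sy r0 yU.
have sub t : t <= 27 * r -> ball y t `<=` U.
  by move=> tr; apply: subset_trans yU; exact: le_ball.
have d0 (t : R) A B : (mu A <= t%:E * mu B)%E -> 
   (D%:E * mu A <= (D * t)%:E * mu B)%E.
  by move=> AB; rewrite EFinM -muleA; apply: lee_wpmul2l.
have e1 : 27 * r = 3 * (9 * r) by lra.
have e2 : 9 * r = 3 * (3 * r) by lra.
rewrite e1; apply: le_trans (doubling _ _ _) _ => //; [lra|by rewrite -e1|].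
rewrite exprS; apply/d0.
rewrite e2; apply: le_trans (doubling _ _ _) _ => //; [lra|apply: sub; lra|].
rewrite exprS expr1; apply/d0.
by apply: doubling => //; apply: sub; lra.
Qed.

(** Induction on the rank gap; for [k = 0] nothing lies strictly between [a] and [b], so [bad a b]
    is empty. The factor [9 ^+ k * 3] leaves room in [U] for balls of radius 27t with t at most r/9,
    centred in the ball of radius r. *)
Lemma bad_measure k a b y (r : R) : ltT a b -> (rk b <= rk a + k.+1)%N ->
  S y -> 0 < r -> ball y (9 ^+ k * 3 * r) `<=` U ->
  (forall c, ltT a c -> ltT c b -> exists z, [/\ ball y r z, S z & rho <= psi c z]) ->
  outer_le mu (ball y r `&` S `&` bad a b)
    ((bad_const k)%:E * kappa%:E * mu (ball y r))%E.
Proof.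
elim: k a b y r => [|k IH] a b y r ab rkab Sy r0 yU big.
  rewrite /= !mul0e.
  suff -> : ball y r `&` S `&` bad a b = set0 by exact: outer_le_set0.
  rewrite -subset0 => x [_ /(bad_between ab)[c [/rk_lt ac /rk_lt cb _]]].
  by have := leq_ltn_trans ac cb; rewrite ltnNge -addn1 rkab.
pose E := ball y r `&` S `&` bad a b.
have [E0|/set0P E0] := eqVneq E set0.
  rewrite -/E E0; apply: outer_le_set0.
  by rewrite mule_ge0// mule_ge0// lee_fin ?bad_const_ge0.
(* The scale at which some psi c stays below rho near x, while every psi c
   reaches rho at three times that scale. *)
have /choice[sc Hsc] x : exists cs : T * R, E x ->
    [/\ ltT a cs.1 /\ ltT cs.1 b, 0 < cs.2, cs.2 <= r / 9,
      forall z, ball x (9 * cs.2) z -> S z -> psi cs.1 z < rho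
    & forall c, ltT a c -> ltT c b ->
        exists z, [/\ ball x (27 * cs.2) z, S z & rho <= psi c z]].
  have [[[yx Sx] bx]|nE] := pselect (E x); last by exists (a, 1) => /nE.
  (* Scales 3r/3^j are tried in decreasing order. [P 0] fails because the ball of radius 3r about
     [x] contains [ball y r], where every intermediate [psi c] reaches [rho]; semicontinuity makes
     [P j] true for large j. *)
  pose P j := exists c, [/\ ltT a c, ltT c b &
    forall z, ball x (3 * r / 3 ^+ j) z -> S z -> psi c z < rho].
  have nP0 : ~ P 0%N.
    move=> [c [ac cb H]]; have [z [yz Sz]] := big c ac cb.
    apply/negP; rewrite -ltNge; apply: H => //.
    rewrite expr0 divr1; apply: (@ball_subset _ _ _ x y (3 * r) r r) => //.
    - exact: ball_sym.
    - lra.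
  have exP : exists j, `[< P j >].
    have [c [ac cb cx]] := bad_between ab bx.
    have [t t0 Ht] := psi_usc cx.
    have [j jt] : exists j, 3 * r / 3 ^+ j < t.
      exists (Num.truncn (t^-1 * (3 * r))).
      rewrite ltr_pdivrMr ?exprn_gt0// -ltr_pdivrMl//.
      apply: lt_le_trans (truncnS_gt _) _.
      by rewrite -natrX ler_nat ltn_expl.
    exists j; apply/asboolP; exists c; split => // z xz _; apply: Ht.
    by apply: le_ball xz; exact: ltW.
  have [j /asboolP Pj jmin] := ex_minnP exP.
  case: j Pj jmin => // j [c [ac cb H]] jmin.
  have e3 : 3 ^+ j != 0 :> R by rewrite expf_neq0.
  have e1 : 9 * (r / 3 / 3 ^+ j.+1) = 3 * r / 3 ^+ j.+1.
    by rewrite exprS; field.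
  have e2 : 27 * (r / 3 / 3 ^+ j.+1) = 3 * r / 3 ^+ j.
    by rewrite exprS; field.
  (* Nine times this radius is the first scale where [P] holds; 27 times it is the preceding scale,
     where [P] fails by minimality. *)
  exists (c, r / 3 / 3 ^+ j.+1) => _; split => /=.
  - by [].
  - by rewrite !divr_gt0// exprn_gt0.
  - rewrite -(@ler_pM2l _ 27)// e2 ler_pdivrMr ?exprn_gt0//.
    rewrite (_ : 27 * (r / 9) = 3 * r); last by field.
    have h3 : 1 <= 3 ^+ j :> R by apply: exprn_ege1; lra.
    by apply: ler_peMr => //; rewrite mulr_ge0// ltW.
  - by rewrite e1.
  - rewrite e2 => c' ac' cb'.
    apply: contrapT => nz.
    suff /asboolP /jmin : P j by rewrite ltnn.
    exists c'; split => // z xz Sz; rewrite ltNge; apply/negP => cz.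
    by apply: nz; exists z.
have t0 x : E x -> 0 < (sc x).2 by move=> /Hsc[].
have [f [fE Ef]] := lindelof_balls E0 t0.
pose s n : seq (X * R) := [seq (f i, (sc (f i)).2) | i <- iota 0 n].
(* The countable cover is exhausted by finite ones, so a finite Vitali selection suffices. *)
have EE : E = E `&` \bigcup_n [set x | exists2 i, i \in s n & ball i.1 i.2 x].
  apply/seteqP; split => [x Ex|x []//]; split => //.
  have [n _ nx] := Ef x Ex; exists n.+1 => //.
  exists (f n, (sc (f n)).2) => //; apply/mapP; exists n => //.
  by rewrite mem_iota add0n leq0n ltnSn.
rewrite -/E EE setI_bigcupr; apply: outer_le_bigcup => [n m nm x [Ex [i + xi]]|n].
  move=> /mapP[l]; rewrite mem_iota => /andP[l0 ln] il.
  split => //; exists i => //; apply/mapP; exists l => //.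
  by rewrite mem_iota l0 (leq_trans ln)// !add0n.
have [s' [s's cover sums]] := finite_vitali mu (s n).
pose F (i : X * R) := E `&` ball i.1 (3 * i.2).
(* The cost of one selected ball relative to its own measure. The selected balls all lie in
   [ball y (3 * r)], which accounts for the remaining factor [D]. *)
pose cst := (1 + 2 * bad_const k) * kappa * D ^+ 3.
pose M := (\sum_(i <- s') cst%:E * mu (ball i.1 i.2))%E.
pose FF : set (borel X) := [set x | exists2 i, i \in s' & F i x].
apply: (@outer_leW _ _ _ _ _ FF M _).
- move=> x [Ex [i si xi]].
  by have [j js jx] := cover i x si xi; exists j.
- have cst0 : (0 <= cst%:E :> \bar R)%E.
    by rewrite lee_fin !mulr_ge0 ?exprn_ge0// addr_ge0// mulr_ge0// bad_const_ge0.
  rewrite /M -ge0_sume_distrr; last by move=> *; exact: measure_ge0.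
  apply: (@le_trans _ _ (cst%:E * (D%:E * mu (ball y r)))%E).
    apply: lee_wpmul2l => //; apply: (le_trans (sums (ball y (3 * r)) _ _)).
    - exact: measurable_ball.
    - move=> i /s's /mapP[l _ ->] /=.
      have [[[yz _] _] [_ tpos t9 _ _]] := (fE l, Hsc _ (fE l)).
      by apply: (ball_subset yz); lra.
    - apply: doubling => //; apply: subset_trans yU; apply: le_ball.
      have h9 : 1 <= 9 ^+ k.+1 :> R by apply: exprn_ege1; lra.
      by nra.
  rewrite muleA -!EFinM (_ : cst * D = D ^+ 4 * (1 + 2 * bad_const k) * kappa)//.
  by rewrite /cst; ring.
apply: outer_le_bigcup_seq => i /s's /mapP[l _ ->] {i}.
set z := f l.
have Ez : E z by exact: fE.
have [[yz Sz] bz] := Ez.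
have [[lt_a lt_b] sz0 sz9 small bigz] := Hsc _ Ez.
rewrite /F /=; move: lt_a lt_b sz0 sz9 small bigz.
move: (sc z).1 (sc z).2 => c t lt_a lt_b t_gt0 t9 small bigz.
have zU : ball z (9 ^+ k * 3 * (27 * t)) `<=` U.
  apply: (subset_trans _ yU). apply: (ball_subset yz).
  have h9 : 1 <= 9 ^+ k :> R by apply: exprn_ege1; lra.
  rewrite exprS; nra.
have zU' : ball z (27 * t) `<=` U.
  apply: subset_trans zU; apply: le_ball.
  have h9 : 1 <= 9 ^+ k :> R by apply: exprn_ege1; lra.
  by nra.
have sub a' b' : ltT a' b' -> (rk b' <= rk a' + k.+1)%N ->
    (forall e, ltT a' e -> ltT e b' -> ltT a e /\ ltT e b) ->
    outer_le mu (ball z (27 * t) `&` S `&` bad a' b')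
    ((bad_const k)%:E * kappa%:E * mu (ball z (27 * t)))%E.
  move=> ab' rkab' H; apply: IH => //; first by rewrite mulr_gt0.
  by move=> e ae eb; apply: bigz; have [] := H e ae eb.
have rk_a := rk_lt lt_a; have rk_b := rk_lt lt_b.
have h1 := sub _ _ lt_a _ _.
have h2 := sub _ _ lt_b _ _.
have h3 := good Sz _ zU' (bigz _ lt_a lt_b).
apply: (outer_leW _ _ (outer_leU (outer_leU (h1 _ _) (h2 _ _)) (h3 _))).
- move=> x [[[yx Sx] bx] zx].
  have zx27 : ball z (27 * t) x by apply: le_ball zx; lra.
  have cx : psi c x < rho by apply: small => //; apply: le_ball zx; lra.
  by have [|[|]] := bad_split lt_a lt_b bx cx; [right|left; left|left; right].
- have -> : ((bad_const k)%:E * kappa%:E * mu (ball z (27 * t)) +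
      (bad_const k)%:E * kappa%:E * mu (ball z (27 * t)) +
      kappa%:E * mu (ball z (27 * t)) =
      ((1 + 2 * bad_const k) * kappa)%:E * mu (ball z (27 * t)))%E.
    have b0 := bad_const_ge0 k.
    rewrite -!EFinM -!ge0_muleDl ?lee_fin ?addr_ge0 ?mulr_ge0//.
    by rewrite -!EFinD; congr (_%:E * _)%E; ring.
  rewrite [X in (_ <= X * _)%E]EFinM -muleA; apply: lee_wpmul2l.
    by rewrite lee_fin mulr_ge0// addr_ge0// mulr_ge0// bad_const_ge0.
  exact: doubling3.
- by lia.
- by move=> e ae ec; split => //; exact: ltT_trans ec lt_b.
- by lia.
- by move=> e ce eb; split => //; exact: ltT_trans lt_a ce.
- by rewrite mulr_gt0.
Qed.

End Nondivergence.

(** * Norms of algebraic integers *)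

Section Integers.
Variable K : fieldExtType rat.

Lemma ringOfIntegers1 : @ringOfIntegers K 1. Proof. exact: integral1. Qed.

Lemma ringOfIntegers0 : @ringOfIntegers K 0. Proof. exact: mxpoly.integral0. Qed.

Lemma ringOfIntegersD a b :
  @ringOfIntegers K a -> ringOfIntegers b -> ringOfIntegers (a + b).
Proof. exact: integral_add. Qed.

Lemma ringOfIntegersM a b :
  @ringOfIntegers K a -> ringOfIntegers b -> ringOfIntegers (a * b).
Proof. exact: integral_mul. Qed.

Lemma ringOfIntegers_sum (I : finType) (F : I -> K) :
  (forall i, ringOfIntegers (F i)) -> ringOfIntegers (\sum_i F i).
Proof.
move=> H; apply: (big_ind (@ringOfIntegers K)) => //.
- exact: ringOfIntegers0.
- exact: ringOfIntegersD.
Qed.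

Lemma ringOfIntegers_det n (A : 'M[K]_n) :
  (forall i j, ringOfIntegers (A i j)) -> ringOfIntegers (\det A).
Proof.
move=> H; apply: ringOfIntegers_sum => s; apply: ringOfIntegersM.
  by case: (perm.odd_perm s) => /=;
    [rewrite expr1; exact/integral_opp/integral1|rewrite expr0; exact: ringOfIntegers1].
apply: (big_ind (@ringOfIntegers K)) => //; first exact: ringOfIntegers1.
exact: ringOfIntegersM.
Qed.

End Integers.

Section Norm.
Variables (R : realType) (K : fieldExtType rat).

(** The relation at [y * x] minus [sigma j y] times the relation at [x] no longer involves [j];
    choosing [y] with [sigma i y != sigma j y] and applying induction gives [c i = 0]. *)
Lemma dedekind_independence (I : eqType) (sigma : I -> {rmorphism K -> R})
    (c : I -> R) (s : seq I) : uniq s ->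
  (forall i j, sigma i =1 sigma j -> i = j) ->
  (forall x, \sum_(i <- s) c i * sigma i x = 0) ->
  forall i, i \in s -> c i = 0.
Proof.
move=> + sigma_inj; elim: s c => // j s IH c /= /andP[js us] sum0.
have cs i : i \in s -> c i = 0.
  move=> si.
  have [y ny] : exists y, sigma i y != sigma j y.
    apply: contrapT => ny; move: js; suff -> : j = i by rewrite si.
    apply: sigma_inj => y; apply/eqP/negPn/negP => ny'.
    by apply: ny; exists y; rewrite eq_sym.
  have /IH : forall x, \sum_(i <- s) c i * (sigma i y - sigma j y) * sigma i x = 0.
    move=> x; have e1 := sum0 (y * x); have e2 := sum0 x.
    move: e1 e2; rewrite !big_cons => e1 /eqP; rewrite addr_eq0 => /eqP e2.
    under eq_bigr => k _ do rewrite mulrBr mulrBl -mulrA -rmorphM mulrAC.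
    rewrite sumrB -mulr_suml; apply/eqP; rewrite subr_eq0; apply/eqP.
    move: e1; rewrite rmorphM mulrCA e2 => /eqP; rewrite addr_eq0 => /eqP e1.
    by apply: oppr_inj; rewrite -e1; ring.
  by move=> /(_ us i si) /eqP; rewrite mulf_eq0 subr_eq0 (negbTE ny) orbF => /eqP.
move=> i; rewrite inE => /predU1P[->|/cs//].
have := sum0 1; rewrite big_cons rmorph1 mulr1 big_seq big1 ?addr0// => k ks.
by rewrite cs// mul0r.
Qed.

(** The monic integral equation is transported from [R] to the rationals and then to [algC], where
    rational algebraic integers are known to be integers. *)
Lemma integral_rat_int (q : rat) :
  integralOver (intr : int -> R) (ratr q) -> exists z : int, q = z%:~R.
Proof.
move=> [p p_monic rp].
have rq : root (map_poly intr p) q.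
  move: rp; rewrite /root (_ : map_poly intr p = map_poly (@ratr R) (map_poly intr p)).
    by rewrite horner_map fmorph_eq0.
  by rewrite -map_poly_comp; apply: eq_map_poly => z /=; rewrite ratr_int.
have /Cint_rat_Aint : (ratr q : algC) \in Crat by exact: Crat_rat.
have -> : (ratr q : algC) \in Aint.
  apply: (@root_monic_Aint (map_poly intr p)).
  - rewrite (_ : map_poly intr p = map_poly (@ratr algC) (map_poly intr p)).
      by rewrite /root horner_map fmorph_eq0.
    by rewrite -map_poly_comp; apply: eq_map_poly => z /=; rewrite ratr_int.
  - exact: monic_map.
  - by apply/polyOverP => i; rewrite coef_map /=.
move=> /(_ isT)/intrP[z qz]; exists z.
by apply: (fmorph_inj (@ratr algC)); rewrite /= qz ratr_int.
Qed.

Variables (d : nat) (sigma : 'I_d -> {rmorphism K -> R}).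
Hypothesis dimK : \dim {:K} = d.
Hypothesis sigma_inj : forall i j, sigma i =1 sigma j -> i = j.

(** This is the field norm: with [E] the matrix of embeddings of a rational basis and [M] the
    rational matrix of multiplication by [a], [E] conjugates the transpose of [M] to the diagonal
    matrix of the [sigma i a]. *)
Lemma prod_sigma_rat a : exists q : rat, \prod_i sigma i a = ratr q.
Proof.
subst d.
pose e := vbasis {:K}.
have sZ i (q : rat) x : sigma i (q *: x) = ratr q * sigma i x.
  rewrite -mulr_algl rmorphM/= -(fmorph_rat (sigma i)).
  by congr (sigma i _ * _); rewrite alg_num_field.
have exp x : x = \sum_j coord e j x *: e`_j by rewrite -coord_vbasis// memvf.
pose E : 'M[R]_(\dim {:K}) := \matrix_(i, j) sigma i e`_j.
pose M : 'M[rat]_(\dim {:K}) := \matrix_(j, k) coord e k (a * e`_j).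
exists (\det M).
(* A vector in the left kernel of [E] would be a linear relation between the distinct embeddings. *)
have detE : \det E != 0.
  rewrite -unitfE -unitmxE -row_free_unit -kermx_eq0; apply/eqP/row_matrixP => i.
  rewrite row0; set c := row i _.
  have cE : c *m E = 0 by rewrite /c -row_mul mulmx_ker row0.
  apply/rowP => j; rewrite [RHS]mxE.
  apply: (@dedekind_independence _ sigma (fun k => c ord0 k) (index_enum _)) => //.
  - exact: index_enum_uniq.
  - move=> x; rewrite (exp x).
    under eq_bigr => k _ do rewrite raddf_sum mulr_sumr.
    rewrite exchange_big big1// => l _.
    move: cE => /matrixP /(_ ord0 l); rewrite !mxE => cE.
    apply: (@etrans _ _ (ratr (coord e l x) * 0)); last by rewrite mulr0.
    apply: etrans (congr1 (fun t => ratr (coord e l x) * t) cE).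
    rewrite mulr_sumr; apply: eq_bigr => k _.
    by rewrite /= sZ [E _ _]mxE mulrCA.
  - by rewrite mem_index_enum.
have eqM : E *m (map_mx ratr M)^T = diag_mx (\row_i sigma i a) *m E.
  apply/matrixP => i j; rewrite mul_diag_mx !mxE -rmorphM (exp (a * _)) raddf_sum.
  by apply: eq_bigr => k _; rewrite /= !mxE sZ mulrC.
move: (congr1 determinant eqM); rewrite !det_mulmx det_tr det_diag det_map_mx mulrC.
by move=> /(mulIf detE) ->; apply: eq_bigr => i _; rewrite mxE.
Qed.

(** The norm is rational and integral over the integers, hence an integer, and it is nonzero. *)
Lemma prod_sigma_ge1 a : ringOfIntegers a -> a != 0 ->
  1 <= \prod_i `|sigma i a|.
Proof.
move=> intA a0.
have [q eq] := prod_sigma_rat a.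
have [|z qz] := @integral_rat_int q.
  rewrite -eq; apply: (big_ind (integralOver (intr : int -> R))).
  - exact: integral1.
  - exact: integral_mul.
  - move=> i _; have [p pm rp] := intA; exists p => //.
    have -> : map_poly intr p = map_poly (sigma i) (map_poly intr p).
      by rewrite -map_poly_comp; apply: eq_map_poly => z /=; rewrite rmorph_int.
    by rewrite /root horner_map fmorph_eq0.
rewrite -normr_prod eq qz ratr_int -intr_norm.
have : \prod_i sigma i a != 0.
  by apply/prodf_neq0 => i _; rewrite fmorph_eq0.
rewrite eq qz ratr_int intr_eq0 => z0.
by rewrite -[1]/(1%:~R) ler_int -gtz0_ge1 normr_gt0.
Qed.

End Norm.

(** * Covolumes along the flow *)

Section Flow.
Variables (R : realType) (m : nat) (a b : R).

Definition homog (x : 'rV[R]_m) : 'cV[R]_m.+1 := col_mx (1%:M : 'M[R]_1) x^T.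

(* Each row (q_0, q) of A becomes (a (q_0 + q.x), b q). *)
Definition flow r (A : 'M[R]_(r, m.+1)) (x : 'rV[R]_m) : 'M[R]_(r, m.+1) :=
  \matrix_(i, j) if j == ord0 then a * (A *m homog x) i ord0 else b * A i j.

Definition minor r (A : 'M[R]_(r, m.+1)) (x : 'rV[R]_m)
    (J : {ffun 'I_r -> 'I_m.+1}) : R := \det (colsub J (flow A x)).

(* Plucker coordinates indexed by all maps J: the non-injective ones vanish. *)
Definition covol r (A : 'M[R]_(r, m.+1)) (x : 'rV[R]_m) : R :=
  \big[Num.max/0]_J `|minor A x J|.

Definition vnorm (v : 'rV[R]_m.+1) (x : 'rV[R]_m) : R :=
  \big[Num.max/0]_j `|flow v x ord0 j|.

Lemma covol_ge0 r (A : 'M[R]_(r, m.+1)) x : 0 <= covol A x.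
Proof. exact: bigmax_ge_id. Qed.

Lemma minor_le_covol r (A : 'M[R]_(r, m.+1)) x J : `|minor A x J| <= covol A x.
Proof. by apply: (le_bigmax _ (fun J => `|minor A x J|)). Qed.

Lemma covol_eq_minor r (A : 'M[R]_(r, m.+1)) x : 0 < covol A x ->
  exists J, covol A x = `|minor A x J|.
Proof.
move=> c0.
have [J0|nJ] := pselect (exists J : {ffun 'I_r -> 'I_m.+1}, true).
  case: J0 => J0 _.
  have [J _ ->] : {J | J \in predT & covol A x = `|minor A x J|}.
    by apply: (eq_bigmax J0).
  by exists J.
move: c0; rewrite /covol big_pred0 ?ltxx// => J.
by exfalso; apply: nJ; exists J.
Qed.

Lemma vnorm_ge0 v x : 0 <= vnorm v x.
Proof. exact: bigmax_ge_id. Qed.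

Lemma flow_mulmx r s (P : 'M[R]_(s, r)) (A : 'M[R]_(r, m.+1)) x :
  flow (P *m A) x = P *m flow A x.
Proof.
apply/matrixP => i j; rewrite [LHS]mxE [RHS]mxE.
case: (eqVneq j ord0) => [->|j0].
  rewrite -mulmxA mxE mulr_sumr; apply: eq_bigr => k _.
  by rewrite [flow _ _ _ _]mxE eqxx mulrCA.
rewrite mxE mulr_sumr; apply: eq_bigr => k _.
by rewrite [flow _ _ _ _]mxE (negbTE j0) mulrCA.
Qed.

Lemma flow_row r (A : 'M[R]_(r, m.+1)) x i j :
  flow A x i j = flow (row i A) x ord0 j.
Proof. by rewrite rowE flow_mulmx -rowE [RHS]mxE. Qed.

Lemma covol_mulmx r (P : 'M[R]_r) (A : 'M[R]_(r, m.+1)) x :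
  covol (P *m A) x = `|\det P| * covol A x.
Proof.
have minorM J : minor (P *m A) x J = \det P * minor A x J.
  by rewrite /minor flow_mulmx -mulmx_colsub det_mulmx.
rewrite /covol; apply/le_anti/andP; split.
  apply: bigmax_le => [|J _].
    by rewrite mulr_ge0// bigmax_ge_id.
  by rewrite minorM normrM ler_wpM2l//; exact: minor_le_covol.
have [->|P0] := eqVneq (\det P) 0; first by rewrite normr0 mul0r bigmax_ge_id.
rewrite mulrC -ler_pdivlMr ?normr_gt0//; apply: bigmax_le => [|J _].
  by rewrite divr_ge0// bigmax_ge_id.
rewrite ler_pdivlMr ?normr_gt0// -normrM mulrC -minorM.
exact: (@minor_le_covol _ (P *m A)).
Qed.

(** Laplace expansion along the row of [v]: each of the r+1 terms is an entry of the flowed [v]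
    times a minor of [A]. *)
Lemma covol_col_mx r (v : 'rV[R]_m.+1) (A : 'M[R]_(r, m.+1)) x :
  covol (col_mx v A : 'M[R]_(1 + r, m.+1)) x <= r.+1%:R * (vnorm v x * covol A x).
Proof.
apply: bigmax_le => [|J _].
  by rewrite !mulr_ge0// ?vnorm_ge0 ?covol_ge0.
rewrite /minor (expand_det_row _ (ord0 : 'I_(1 + r))).
apply: (le_trans (ler_norm_sum _ _ _)).
rewrite mulr_natl -[X in _ *+ X](card_ord (1 + r)) -sumr_const.
apply: ler_sum => k _; rewrite normrM; apply: ler_pM => //.
  rewrite (_ : colsub _ _ _ _ = flow v x ord0 (J k)).
    exact: (le_bigmax _ (fun j => `|flow v x ord0 j|)).
  have -> : (ord0 : 'I_(1 + r)) = lshift r (ord0 : 'I_1) by apply: val_inj.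
  by rewrite mxE flow_row rowKu -flow_row.
rewrite /cofactor normrM normrX normrN1 expr1n mul1r.
pose J' : {ffun 'I_r -> 'I_m.+1} := [ffun l => J (lift k l)].
suff -> : row' (ord0 : 'I_(1 + r)) (col' k (colsub J (flow (col_mx v A) x))) =
   colsub J' (flow A x) by exact: minor_le_covol.
apply/matrixP => i l; rewrite 3!mxE [RHS]mxE ffunE.
have -> : lift (ord0 : 'I_(1 + r)) i = rshift 1 i by apply: val_inj.
by rewrite flow_row rowKd -flow_row.
Qed.

Definition upd r (J : {ffun 'I_r -> 'I_m.+1}) k j : {ffun 'I_r -> 'I_m.+1} :=
  [ffun l => if l == k then j else J l].

(* Only column k of the flowed matrix depends on x; the determinant is expanded
   along it. *)
Lemma minor_expand r (A : 'M[R]_(r.+1, m.+1)) x (J : {ffun 'I_r.+1 -> 'I_m.+1}) k :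
  J k = ord0 ->
  (forall l, l != k -> J l != ord0) ->
  minor A x J = a * b ^+ r * (\sum_j homog x j ord0 * \det (colsub (upd J k j) A)).
Proof.
move=> Jk Jl; rewrite /minor.
pose B : 'M[R]_r.+1 := \matrix_(i, l) if l == k then (A *m homog x) i ord0 else A i (J l).
pose D : 'rV[R]_r.+1 := \row_l if l == k then a else b.
have -> : colsub J (flow A x) = B *m diag_mx D.
  apply/matrixP => i l; rewrite mul_mx_diag !mxE.
  case: (eqVneq l k) => [->|lk]; first by rewrite Jk eqxx mulrC.
  by rewrite (negbTE (Jl _ lk)) mulrC.
rewrite det_mulmx det_diag mulrC; congr (_ * _).
  rewrite (bigD1 k)//= mxE eqxx; congr (_ * _).
  rewrite (eq_bigr (fun=> b)) => [|l lk]; last by rewrite mxE (negbTE lk).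
  by rewrite prodr_const cardC1 card_ord.
rewrite (expand_det_col _ k).
under eq_bigr => i _ do rewrite mxE eqxx mxE mulr_suml.
rewrite exchange_big /=; apply: eq_bigr => j _.
rewrite (expand_det_col _ k) mulr_sumr; apply: eq_bigr => i _.
have -> : cofactor B i k = cofactor (colsub (upd J k j) A) i k.
  rewrite /cofactor; congr (_ * \det _); apply/matrixP => u w; rewrite !mxE ffunE.
  by rewrite eq_sym (negbTE (neq_lift _ _)).
by rewrite [colsub _ _ _ _]mxE ffunE eqxx -!mulrA mulrCA.
Qed.

Lemma sum_homog (c : 'I_m.+1 -> R) x :
  \sum_j homog x j ord0 * c j = c ord0 + \sum_(j < m) c (lift ord0 j) * x ord0 j.
Proof.
rewrite big_ord_recl; congr (_ + _).
  have -> : homog x ord0 ord0 = 1; last by rewrite mul1r.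
  have e1 : (1%:M : 'M[R]_1) ord0 ord0 = 1 by rewrite mxE eqxx.
  rewrite -e1; apply: etrans (col_mxEu _ x^T ord0 ord0).
  by congr (col_mx _ _ _ _); apply: val_inj.
apply: eq_bigr => j _; rewrite mulrC; congr (_ * _).
have e1 : x^T j ord0 = x ord0 j by rewrite mxE.
rewrite -e1; apply: etrans (col_mxEd (1%:M : 'M[R]_1) x^T j ord0).
by congr (col_mx _ _ _ _); apply: val_inj.
Qed.

(** Only column 0 of the flowed matrix depends on [x]. If [J] avoids it the minor is constant, if
    [J] takes it twice the minor vanishes, and otherwise the expansion along that column is
    affine. *)
Lemma minor_affine r (A : 'M[R]_(r, m.+1)) J : exists (c0 : R) (c : 'rV[R]_m),
  forall x, minor A x J = c0 + \sum_j c ord0 j * x ord0 j.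
Proof.
have const t : (forall x, minor A x J = t) -> exists (c0 : R) (c : 'rV[R]_m),
    forall x, minor A x J = c0 + \sum_j c ord0 j * x ord0 j.
  move=> H; exists t, 0 => x; rewrite H big1 ?addr0// => j _.
  by rewrite mxE mul0r.
have [[k Jk]|nJ] := pselect (exists k, J k = ord0); last first.
  apply: (const (\det (colsub J (flow A 0)))) => x; congr (\det _).
  apply/matrixP => i l; rewrite !mxE; case: eqP => // Jl.
  by exfalso; apply: nJ; exists l.
have [Jinj|] := pselect (forall l, l != k -> J l != ord0); last first.
  move/existsNP => [l /not_implyP[lk /negP/negPn/eqP Jl]].
  apply: (const 0) => x; rewrite /minor -det_tr.
  apply: (determinant_alternate lk) => i.
  by rewrite !mxE Jl Jk.
case: r A J k Jk Jinj const => [|r] A J k Jk Jinj _; first by case: k Jk Jinj.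
exists (a * b ^+ r * \det (colsub (upd J k ord0) A)).
exists (\row_j (a * b ^+ r * \det (colsub (upd J k (lift ord0 j)) A))) => x.
rewrite (minor_expand _ _ Jk Jinj) sum_homog mulrDr; congr (_ + _).
rewrite mulr_sumr; by apply: eq_bigr => j _; rewrite mxE mulrA.
Qed.

End Flow.

Section NonzeroMinor.
Variables (F : fieldType) (m : nat).

Lemma row_free_minor r (A : 'M[F]_(r, m.+1)) : row_free A ->
  exists J : {ffun 'I_r -> 'I_m.+1}, \det (colsub J A) != 0.
Proof.
move=> fA.
have fAT : row_full A^T by rewrite /row_full mxrank_tr.
exists (fullrankfun fAT).
have := fullrowsub_unit fAT; rewrite unitmxE unitfE -det_tr.
by congr (\det _ != 0); apply/matrixP => i j; rewrite !mxE.
Qed.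

Lemma row_free_col_mx r n (v : 'rV[F]_n) (A : 'M[F]_(r, n)) :
  row_free A -> ~~ (v <= A)%MS -> row_free (col_mx v A : 'M[F]_(1 + r, n)).
Proof.
move=> fA nv; have : (A < col_mx v A)%MS.
  by rewrite ltmxE col_mx_sub (negbTE nv) andbT -addsmxE addsmxSr.
by rewrite ltmxErank (eqP fA) /row_free eqn_leq rank_leq_row => /andP[].
Qed.

(** Some minor using column 0 exactly once has a nonzero coefficient as an affine function of [x].
    If a nonzero minor of [A] avoids column 0, its first index is replaced by 0 and the old index is
    restored by [upd]. *)
Lemma row_free_upd r (A : 'M[F]_(r.+1, m.+1)) : row_free A ->
  exists (J : {ffun 'I_r.+1 -> 'I_m.+1}) k j, [/\ J k = ord0,
    forall l, l != k -> J l != ord0 & \det (colsub (upd J k j) A) != 0].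
Proof.
move=> /row_free_minor[I dI].
have [[k Ik]|nI] := pselect (exists k, I k = ord0); last first.
  exists (upd I ord0 ord0), ord0, (I ord0); split.
  - by rewrite ffunE eqxx.
  - move=> l l0; rewrite ffunE (negbTE l0); apply/eqP => Il.
    by apply: nI; exists l.
  - suff -> : upd (upd I ord0 ord0) ord0 (I ord0) = I by [].
    by apply/ffunP => l; rewrite !ffunE; case: eqP => // ->.
have updI : upd I k ord0 = I.
  by apply/ffunP => l; rewrite !ffunE; case: eqP => // ->.
exists I, k, ord0; rewrite updI; split => // l lk.
apply: contra_neq dI => Il; rewrite -det_tr.
by apply: (determinant_alternate lk) => i; rewrite !mxE Il Ik.
Qed.

End NonzeroMinor.

(** * Sublattices of O_K^(m+1) *)

Section Lattices.
Variables (R : realType) (K : fieldExtType rat) (d : nat).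
Variable sigma : 'I_d -> {rmorphism K -> R}.
Hypothesis dimK : \dim {:K} = d.
Hypothesis sigma_inj : forall i j, sigma i =1 sigma j -> i = j.
Variable m : nat.

Definition integral_mx r (A : 'M[K]_(r, m.+1)) := forall i j, ringOfIntegers (A i j).

(** The absolute value of the field norm of K over the rationals. *)
Definition knorm (z : K) : R := \prod_i `|sigma i z|.

Lemma knormM y z : knorm (y * z) = knorm y * knorm z.
Proof.
by rewrite /knorm -big_split; apply: eq_bigr => i _; rewrite rmorphM normrM.
Qed.

Lemma knorm_gt0 z : z != 0 -> 0 < knorm z.
Proof. by move=> z0; apply: prodr_gt0 => i _; rewrite normr_gt0 fmorph_eq0. Qed.

Lemma knorm_ge1 z : ringOfIntegers z -> z != 0 -> 1 <= knorm z.
Proof. by move=> *; exact: prod_sigma_ge1. Qed.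

(* Among all integral bases of a subspace of K^(m+1), one whose covolume is
   minimal up to a factor 2; this replaces the norm of the ideal of minors. *)
Record lat := Lat {
  lrk : nat;
  lmx : 'M[K]_(lrk, m.+1);
  lat_int : integral_mx lmx;
  lat_free : row_free lmx;
  lat_min : forall P : 'M[K]_lrk, P \in unitmx -> integral_mx (P *m lmx) ->
    2^-1 <= knorm (\det P) }.

(** A nonzero minor of [P *m A] is an algebraic integer, so its norm is at least 1; this bounds
    [knorm (\det P)] below by a positive constant. [P0] is taken with norm below twice the
    infimum. *)
Lemma exists_minimal r (A : 'M[K]_(r, m.+1)) : integral_mx A -> row_free A ->
  exists P0 : 'M[K]_r, [/\ P0 \in unitmx, integral_mx (P0 *m A) &
    forall P : 'M[K]_r, P \in unitmx -> integral_mx (P *m (P0 *m A)) ->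
      2^-1 <= knorm (\det P)].
Proof.
move=> intA freeA.
have [J dJ] := row_free_minor freeA.
pose E : set R := [set knorm (\det P) | P in
  [set P : 'M[K]_r | P \in unitmx /\ integral_mx (P *m A)]].
have E1 : E 1.
  exists 1%:M; first by rewrite /= mul1mx unitmx1.
  by rewrite det1 /knorm big1// => i _; rewrite rmorph1 normr1.
have Elb : lbound E (knorm (\det (colsub J A)))^-1.
  move=> _ [P [uP intPA] <-].
  rewrite -[leLHS]mul1r ler_pdivrMr ?knorm_gt0// -knormM -det_mulmx mulmx_colsub.
  apply: knorm_ge1.
    by apply: ringOfIntegers_det => i j; rewrite mxE.
  by rewrite -mulmx_colsub det_mulmx mulf_neq0// -unitfE -unitmxE.
have infE : has_inf E by split; [exists 1|exists (knorm (\det (colsub J A)))^-1].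
have inf0 : 0 < inf E.
  apply: (@lt_le_trans _ _ (knorm (\det (colsub J A)))^-1).
    by rewrite invr_gt0 knorm_gt0.
  by apply: lb_le_inf => //; exists 1.
have [_ [P0 [uP0 intP0] <-] P0inf] := inf_adherent inf0 infE.
exists P0; split => // P uP intP.
have P0_gt0 : 0 < knorm (\det P0) by rewrite knorm_gt0// -unitfE -unitmxE.
rewrite -(ler_pM2r P0_gt0) -knormM -det_mulmx.
apply: (@le_trans _ _ (inf E)).
  by rewrite mulrC ler_pdivrMr//; apply: ltW; lra.
apply: ge_inf; first by exists (knorm (\det (colsub J A)))^-1.
by exists (P *m P0) => //=; rewrite unitmx_mul uP uP0 -mulmxA.
Qed.

Variables a b : R.

Definition psi r (A : 'M[K]_(r, m.+1)) (x : 'M[R]_(d, m)) : R :=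
  \prod_i covol a b (map_mx (sigma i) A) (row i x).

Definition vnormS (v : 'rV[K]_m.+1) (x : 'M[R]_(d, m)) : R :=
  \prod_i vnorm a b (map_mx (sigma i) v) (row i x).

Lemma psi_ge0 r (A : 'M[K]_(r, m.+1)) x : 0 <= psi A x.
Proof. by apply: prodr_ge0 => i _; exact: covol_ge0. Qed.

Lemma vnormS_ge0 v x : 0 <= vnormS v x.
Proof. by apply: prodr_ge0 => i _; exact: vnorm_ge0. Qed.

Lemma psi_mulmx r (P : 'M[K]_r) (A : 'M[K]_(r, m.+1)) x :
  psi (P *m A) x = knorm (\det P) * psi A x.
Proof.
rewrite /psi /knorm -big_split /=; apply: eq_bigr => i _.
by rewrite map_mxM covol_mulmx det_map_mx.
Qed.

Lemma psi_col_mx r (v : 'rV[K]_m.+1) (A : 'M[K]_(r, m.+1)) x : (r <= m)%N ->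
  psi (col_mx v A : 'M[K]_(1 + r, m.+1)) x <= m.+1%:R ^+ d * (vnormS v x * psi A x).
Proof.
move=> rm; rewrite /psi /vnormS -big_split /= -[X in _ ^+ X]card_ord -prodr_const.
rewrite -big_split /=; apply: ler_prod => i _; rewrite covol_ge0 /=.
rewrite map_col_mx; apply: le_trans (covol_col_mx _ _ _ _ _) _.
by rewrite ler_wpM2r ?ler_nat// mulr_ge0 ?vnorm_ge0 ?covol_ge0.
Qed.

Definition lat_lt (L M : lat) : Prop := (lmx L < lmx M)%MS.
Definition lat_mem (L : lat) (v : 'rV[K]_m.+1) : Prop :=
  integral_mx v /\ (v <= lmx L)%MS.
Definition lat_psi (L : lat) := psi (lmx L).

Lemma lat_lt_trans L M N : lat_lt L M -> lat_lt M N -> lat_lt L N.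
Proof. by move=> LM /ltmxW; exact: ltmx_sub_trans. Qed.

Lemma lat_lt_rk L M : lat_lt L M -> (lrk L < lrk M)%N.
Proof.
rewrite /lat_lt ltmxErank => /andP[_].
by rewrite (eqP (lat_free L)) (eqP (lat_free M)).
Qed.

Lemma lat_rk_le (L : lat) : (lrk L <= m.+1)%N.
Proof. by rewrite -(eqP (lat_free L)) rank_leq_col. Qed.

Lemma lat_psi_min (L : lat) (P : 'M[K]_(lrk L)) x :
  P \in unitmx -> integral_mx (P *m lmx L) ->
  lat_psi L x <= 2 * psi (P *m lmx L) x.
Proof.
move=> uP intP; rewrite psi_mulmx mulrA -[leLHS]mul1r ler_wpM2r ?psi_ge0//.
by have := lat_min uP intP; lra.
Qed.

(** Stacking [v] on the basis of [L] gives an integral basis [A] of the enlarged subspace, with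
    covolume bounded by [psi_col_mx]. Passing from [A] to a nearly minimal basis costs the factor
    2. *)
Lemma lat_extend (L M : lat) v : lat_lt L M -> lat_mem M v -> ~ lat_mem L v ->
  (forall x, lat_psi M x <= 2 * m.+1%:R ^+ d * lat_psi L x * vnormS v x) \/
  exists N, [/\ lat_lt L N, lat_lt N M &
    forall x, lat_psi N x <= 2 * m.+1%:R ^+ d * lat_psi L x * vnormS v x].
Proof.
move=> LM [intv vM] nv.
have {}nv : ~~ (v <= lmx L)%MS by apply/negP => vL; apply: nv; split.
pose A : 'M[K]_(1 + lrk L, m.+1) := col_mx v (lmx L).
have intA : integral_mx A.
  move=> i j; rewrite /A -(splitK i); case: (fintype.split i) => k /=.
    by rewrite col_mxEu; exact: intv.
  by rewrite col_mxEd; exact: lat_int.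
have LA : (lmx L < A)%MS.
  by rewrite ltmxE /A col_mx_sub (negbTE nv) andbT -addsmxE addsmxSr.
have AM : (A <= lmx M)%MS.
  by rewrite /A col_mx_sub vM; case/andP: LM.
have freeA : row_free A by apply: row_free_col_mx nv; exact: lat_free.
have rL : (lrk L <= m)%N by rewrite -ltnS; apply: leq_trans (lat_lt_rk LM) (lat_rk_le M).
have psiA x t : t <= 2 * psi A x -> t <= 2 * m.+1%:R ^+ d * lat_psi L x * vnormS v x.
  move/le_trans; apply; rewrite -!mulrA ler_pM2l// [_ * vnormS _ _]mulrC.
  exact: psi_col_mx.
have [MA|nMA] := boolP (lmx M <= A)%MS.
  left; move: LM vM AM MA; rewrite /lat_psi; case: M => s B intB freeB minB /=.
  move=> LM vM AM MA x; apply: psiA.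
  (* Here [A] spans the same subspace as [M], so it is an invertible multiple of the basis stored in
     [M], whose minimality applies. *)
  have e : s = (1 + lrk L)%N.
    by rewrite -(eqP freeB) -(eqP freeA); apply/eqP; rewrite eqn_leq !mxrankS.
  subst s.
  have /submxP[P AP] := AM.
  have uP : P \in unitmx.
    rewrite -row_free_unit -kermx_eq0 -mxrank_eq0 mxrank_ker subn_eq0.
    by rewrite -{1}(eqP freeA) AP mxrankM_maxl.
  have := @lat_psi_min (Lat intB freeB minB) P x uP.
  by rewrite /lat_psi /= -AP; apply.
right.
have [P [uP intPA minP]] := exists_minimal intA freeA.
have eqPA : (P *m A :=: A)%MS by apply: eqmxMfull; rewrite row_full_unit.
have freePA : row_free (P *m A) by rewrite /row_free eqPA.
exists (Lat intPA freePA minP); split => [||x]; rewrite /lat_lt /lat_psi /=.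
- by rewrite /ltmx !eqPA.
- by rewrite /ltmx !eqPA AM.
- apply: psiA; rewrite -{2}[A](mulKmx uP).
  have := @lat_psi_min (Lat intPA freePA minP) (invmx P) x.
  by rewrite /lat_psi /= unitmx_inv; apply => //; rewrite mulKmx.
Qed.

(** At every place the same minor is used. Its coefficient of index [j] is [a * b ^+ r], which is at
    least 1, times the image of one nonzero algebraic integer; the product of these images has size
    at least 1, and [spread] loses only [t i] at place [i]. *)
Lemma lat_psi_lower (L : lat) (S : 'I_d -> set 'rV[R]_m) (t : 'I_d -> R) :
  0 <= a -> 0 <= b -> (forall r, (r <= m)%N -> 1 <= a * b ^+ r) ->
  (forall i, 0 <= t i) ->
  (forall i (c : 'I_m.+1 -> R) j, exists2 x, S i x &
     t i * `|c j| <= `|\sum_k homog x k ord0 * c k|) ->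
  (0 < lrk L)%N ->
  exists2 z : 'M[R]_(d, m), (forall i, S i (row i z)) & \prod_i t i <= lat_psi L z.
Proof.
move=> a0 b0 ab t0 spread; rewrite /lat_psi.
have := lat_rk_le L.
case: L => -[//|r] A intA freeA _ /=; rewrite ltnS => rm _.
have [J [k [j [Jk Jl dJ]]]] := row_free_upd freeA.
pose c i l := sigma i (\det (colsub (upd J k l) A)).
have /choice[z Hz] i : exists x, S i x /\
    t i * `|c i j| <= `|\sum_k homog x k ord0 * c i k|.
  by have [x] := spread i (c i) j; exists x.
exists (\matrix_i z i) => [i|]; first by rewrite rowK; have [] := Hz i.
apply: (@le_trans _ _ (\prod_i (t i * `|c i j|))).
  rewrite big_split /= -[leLHS]mulr1; apply: ler_wpM2l.
    by apply: prodr_ge0.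
  apply: knorm_ge1 => //; apply: ringOfIntegers_det => u w.
  by rewrite mxE; exact: intA.
apply: ler_prod => i _; rewrite mulr_ge0//=.
have [_ /le_trans] := Hz i; apply; rewrite rowK.
apply: le_trans (minor_le_covol _ _ _ _ J).
rewrite (minor_expand _ _ _ _ Jk Jl) normrM.
have -> : \sum_k0 homog (z i) k0 ord0 * c i k0 =
    \sum_j0 homog (z i) j0 ord0 * \det (colsub (upd J k j0) (map_mx (sigma i) A)).
  apply: eq_bigr => l _; rewrite /c -det_map_mx; congr (_ * \det _).
  by apply/matrixP => u w; rewrite !mxE.
rewrite ler_peMl// ger0_norm; first exact: ab.
by rewrite mulr_ge0// exprn_ge0.
Qed.

Lemma covol_continuous r (A : 'M[R]_(r, m.+1)) (i : 'I_d) :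
  continuous (fun x : 'M[R]_(d, m) => covol a b A (row i x)).
Proof.
apply: (@continuous_big R _ Num.max 0 predT (@max_continuous _ R) _ _
  (fun J (x : 'M[R]_(d, m)) => `|minor a b A (row i x) J|)).
move=> J _; have [c0 [c cE]] := minor_affine a b A J.
rewrite (_ : (fun _ => _) =
  (fun x : 'M[R]_(d, m) => `|c0 + \sum_j c ord0 j * x i j|)); last first.
  apply/funext => x; rewrite cE; congr `|_ + _|.
  by apply: eq_bigr => j _; rewrite mxE.
move=> x; have Fx := nbhs_filter x.
apply: (@cvg_norm _ R^o _ _ Fx); apply: (@cvgD _ R^o _ _ Fx); first exact: cvg_cst.
apply: (@cvg_big R^o _ _ _ _ (@add_continuous R^o)) => j _.
apply: (@cvgM _ _ _ Fx); first exact: cvg_cst.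
exact: coord_continuous.
Qed.

Lemma psi_continuous r (A : 'M[K]_(r, m.+1)) : continuous (psi A).
Proof.
apply: (@continuous_big R _ *%R 1 predT (@mul_continuous R) _ _
  (fun i (x : 'M[R]_(d, m)) => covol a b (map_mx (sigma i) A) (row i x))).
by move=> i _; exact: covol_continuous.
Qed.

Lemma lat_psi_usc (L : lat) x t : lat_psi L x < t ->
  exists2 r : R, 0 < r & forall y, ball x r y -> lat_psi L y < t.
Proof.
move=> xt.
have /nbhs_ballP[r /= r0 H] : nbhs x [set y | lat_psi L y < t].
  exact: (@psi_continuous _ (lmx L) x _ (lt_nbhsl xt)).
by exists r.
Qed.

End Lattices.

(** * Friendly measures on a single factor *)

Lemma borel_open (T : ptopologicalType) (A : set T) :
  open A -> measurable (A : set (borel T)).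
Proof. exact: sub_sigma_algebra. Qed.

Lemma borel_closed (T : ptopologicalType) (A : set T) :
  closed A -> measurable (A : set (borel T)).
Proof.
move=> cA; rewrite -(setCK A); apply: measurableC.
by apply: borel_open; exact: closed_openC.
Qed.

Section Hyperplane.
Variables (R : realType) (m : nat).
Implicit Types x y c : 'rV[R]_m.

Definition dot c x : R := \sum_j c ord0 j * x ord0 j.

Lemma dotBr c x y : dot c (x - y) = dot c x - dot c y.
Proof. by rewrite /dot -sumrB; apply: eq_bigr => j _; rewrite !mxE mulrBr. Qed.

Lemma dotZr c x t : dot c (t *: x) = t * dot c x.
Proof. by rewrite /dot mulr_sumr; apply: eq_bigr => j _; rewrite !mxE mulrCA. Qed.

Lemma dotC c x : dot c x = dot x c.
Proof. by apply: eq_bigr => j _; rewrite mulrC. Qed.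

Lemma dot_ge0 c : 0 <= dot c c.
Proof. by apply: sumr_ge0 => j _; rewrite -expr2 sqr_ge0. Qed.

Lemma dot_gt0 c : c != 0 -> 0 < dot c c.
Proof.
move=> c0; rewrite lt_neqAle dot_ge0 andbT eq_sym; apply: contra_neq c0 => d0.
apply/rowP => j; rewrite mxE; apply/eqP.
have := @psumr_eq0P _ _ xpredT (fun j => c ord0 j * c ord0 j).
move=> /(_ (fun j _ => sqr_ge0 _) d0 j isT) /eqP.
by rewrite mulf_eq0 orbb.
Qed.

Lemma dot_continuous c : continuous (dot c).
Proof.
move=> x; have Fx := nbhs_filter x.
apply: (@cvg_big R^o _ _ _ _ (@add_continuous R^o)) => j _.
apply: (@cvgM _ _ _ Fx); first exact: cvg_cst.
exact: coord_continuous.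
Qed.

Lemma open_affine_lt (c0 u : R) c : open [set x | `|c0 + dot c x| < u].
Proof.
apply: (@open_comp _ _ (fun x => `|c0 + dot c x|) [set t | t < _]); last exact: open_lt.
move=> x _; have Fx := nbhs_filter x.
apply: (@cvg_norm _ R^o _ _ Fx); apply: (@cvgD _ R^o _ _ Fx); first exact: cvg_cst.
exact: dot_continuous.
Qed.

Lemma cauchy_schwarz c x : `|dot c x| <= Num.sqrt (dot c c) * Num.sqrt (dot x x).
Proof.
rewrite -sqrtrM ?dot_ge0// -sqrtr_sqr ler_wsqrtr//.
have [->|c0] := eqVneq c 0.
  rewrite /dot [X in X ^+ 2]big1 => [|j _]; last by rewrite mxE mul0r.
  by rewrite expr0n mulr_ge0// dot_ge0.
have s0 := dot_gt0 c0.
have := dot_ge0 (x - (dot c x / dot c c) *: c).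
rewrite dotBr dotZr ![dot (x - _) _]dotC !dotBr !dotZr (dotC x c).
rewrite (_ : _ - _ = dot x x - dot c x ^+ 2 / dot c c); last first.
  by field; rewrite gt_eqF.
by rewrite subr_ge0 ler_pdivrMr// mulrC.
Qed.

Lemma euclid_dist_hyperplane c (t : R) x : c != 0 ->
  euclid_dist [set y | dot c y = t] x = `|dot c x - t| / Num.sqrt (dot c c).
Proof.
move=> c0; have s0 := dot_gt0 c0.
have n0 : 0 < Num.sqrt (dot c c) by rewrite sqrtr_gt0.
have distE y : Num.sqrt (\sum_(j < m) (x ord0 j - y ord0 j) ^+ 2) =
    Num.sqrt (dot (x - y) (x - y)).
  by congr Num.sqrt; apply: eq_bigr => j _; rewrite !mxE expr2.
(* The orthogonal projection of [x], where the distance is attained. *)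
pose p := x - ((dot c x - t) / dot c c) *: c.
have cp : dot c p = t.
  by rewrite /p dotBr dotZr divfK ?gt_eqF// opprB addrCA subrr addr0.
have lb : lbound [set Num.sqrt (\sum_(j < m) (x ord0 j - y ord0 j) ^+ 2)%R | y in
    [set y | dot c y = t]] (`|dot c x - t| / Num.sqrt (dot c c)).
  move=> _ [y /= cy <-]; rewrite distE ler_pdivrMr// mulrC -cy -dotBr.
  exact: cauchy_schwarz.
apply/le_anti/andP; split.
  apply: ge_inf; first by exists (`|dot c x - t| / Num.sqrt (dot c c)).
  have xp : x - p = ((dot c x - t) / dot c c) *: c.
    by rewrite /p opprB addrCA subrr addr0.
  exists p => //; rewrite distE xp dotZr [dot (_ *: _) _]dotC dotZr mulrA.
  rewrite -expr2 sqrtrM ?sqr_ge0// sqrtr_sqr normrM mulrAC -mulrA.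
  congr (_ * _); rewrite ger0_norm ?invr_ge0 ?ltW//.
  by rewrite -[X in _ / X](sqr_sqrtr (ltW s0)) expr2 invfM mulrA mulfV ?gt_eqF// mul1r.
apply: lb_le_inf lb.
by exists (Num.sqrt (\sum_(j < m) (x ord0 j - p ord0 j) ^+ 2)); exists p.
Qed.

End Hyperplane.

Section Support.
Variables (R : realType) (m : nat).
Variable nu : {measure set (borel 'rV[R]_m) -> \bar R}.

Lemma msupport_compl (x : 'rV[R]_m) : ~ msupport nu x ->
  exists2 r : R, 0 < r & forall s, s <= r -> nu (ball x s) = 0%E.
Proof.
move=> /existsNP[V /not_implyP[[oV Vx] /negP]]; rewrite -leNgt => V0.
have /nbhs_ballP[r /= r0 rV] : nbhs x V by exact: open_nbhs_nbhs.
exists r => // s sr; apply/eqP; rewrite eq_le measure_ge0 andbT.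
apply: le_trans V0; apply: le_measure; rewrite ?inE.
- exact: measurable_ball.
- exact: borel_open.
- by apply: subset_trans rV; exact: le_ball.
Qed.

Lemma msupport_ball_gt0 (x : 'rV[R]_m) (r : R) :
  msupport nu x -> 0 < r -> (0 < nu (ball x r))%E.
Proof. by move=> sx r0; apply: sx; exact: ball_open_nbhs. Qed.

(** Every point off the support has a null ball around it, and countably many of these cover the
    complement. *)
Lemma negligible_msupportC : nu.-negligible (~` msupport nu).
Proof.
have [->|/set0P E0] := eqVneq (~` msupport nu) set0; first exact: negligible_set0.
have /choice[r Hr] (x : 'rV[R]_m) : exists r : R, ~ msupport nu x ->
    0 < r /\ nu (ball x r) = 0%E.
  have [sx|/msupport_compl[r r0 H]] := pselect (msupport nu x).
    by exists 1 => /(_ sx).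
  by exists r => _; split => //; exact: H.
have [y [yE Ey]] := lindelof_balls E0 (fun x Ex => (Hr x Ex).1).
apply: (negligibleS (mu := nu) Ey); apply: negligible_bigcup => n.
exists (ball (y n) (r (y n))); split => //; first exact: measurable_ball.
by have [] := Hr _ (yE n).
Qed.

Lemma radon_ball_lty (x : 'rV[R]_m) (r : R) : radon nu -> (nu (ball x r) < +oo)%E.
Proof.
move=> [fin _].
pose B := [set v : 'rV[R]_m | forall j, v ord0 j \in `[x ord0 j - r, x ord0 j + r]].
have cB : compact B.
  apply: (@rV_compact _ _ (fun j => `[x ord0 j - r, x ord0 j + r]%classic)) => j.
  exact: segment_compact.
apply: le_lt_trans (fin _ cB); apply: le_measure; rewrite ?inE.
- exact: measurable_ball.
- by apply: borel_closed; apply: compact_closed => //; exact: norm_hausdorff.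
- move=> y xy j; have r0 := ball_center_gt0 xy.
  move: xy => /(mx_ballE _ _ r0)/(_ ord0 j); rewrite in_itv/= ltr_norml; lra.
Qed.

Lemma federer_doubling (D : R) (U : set 'rV[R]_m) y (r : R) :
  radon nu -> federer nu D U -> msupport nu y -> 0 < r -> ball y (3 * r) `<=` U ->
  (nu (ball y (3 * r)) <= D%:E * nu (ball y r))%E.
Proof.
move=> rad [_ _ supD] sy r0 yU.
have n0 := msupport_ball_gt0 sy r0.
have finr : nu (ball y r) \is a fin_num.
  by rewrite ge0_fin_numE ?measure_ge0// radon_ball_lty.
have : (nu (ball y (3 * r)) / nu (ball y r) <= D%:E)%E.
  apply: le_trans (ltW supD); apply: ereal_sup_ubound.
  by exists y, r; split.
rewrite -(fineK finr) in n0 *; rewrite inver gt_eqF//.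
by rewrite -lee_pdivrMr// muleC.
Qed.

(** Decay in terms of affine functions: the distance to the zero hyperplane is the absolute value
    divided by the norm of [c], which cancels in the ratio. *)
Lemma nonconcentration (C alpha : R) (U : set 'rV[R]_m) :
  0 < C -> 0 < alpha -> decaying nu C alpha U ->
  forall delta : R, 0 < delta -> exists2 eta : R, 0 < eta <= 1 &
  forall y (r : R), msupport nu y -> 0 < r -> ball y r `<=` U ->
  forall (c0 : R) (c : 'rV[R]_m) z, ball y r z -> msupport nu z ->
    0 < `|c0 + dot c z| ->
    (nu (ball y r `&` [set x | (`|c0 + dot c x| < eta * `|c0 + dot c z|)%R])
      <= delta%:E * nu (ball y r))%E.
Proof.
move=> C0 al0 dec delta d0.
(* Chosen so that C eta^alpha is at most [delta]; the cap 1 makes the set empty when the affine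
   function is constant. *)
pose eta := Num.min 1 ((delta / C) `^ alpha^-1).
have eta0 : 0 < eta by rewrite lt_min ltr01 powR_gt0// divr_gt0.
have eta1 : eta <= 1 by rewrite ge_min lexx.
exists eta; first by rewrite eta0.
move=> y r sy r0 yU c0 c z yz sz z0.
have [c_0|cn0] := eqVneq c 0.
  have dotc x : dot c x = 0 by rewrite /dot c_0 big1// => j _; rewrite mxE mul0r.
  rewrite (_ : _ `&` _ = set0); last first.
    rewrite -subset0 => x [_]; rewrite /= !dotc => /lt_le_trans.
    rewrite dotc in z0.
    by move=> /(_ _ (ler_piMl (ltW z0) eta1)); rewrite ltxx.
  by rewrite measure0 mule_ge0// lee_fin ltW.
pose L := [set x | dot c x = - c0].
have hL : affine_hyperplane L by exists c, (- c0).
have n0 : 0 < Num.sqrt (dot c c) by rewrite sqrtr_gt0 dot_gt0.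
have dL x : euclid_dist L x = `|c0 + dot c x| / Num.sqrt (dot c c).
  by rewrite /L euclid_dist_hyperplane// opprK addrC.
have dz : 0 < euclid_dist L z by rewrite dL divr_gt0.
have -> : [set x | `|c0 + dot c x| < eta * `|c0 + dot c z|] =
    thickening L (eta * euclid_dist L z).
  apply/seteqP; split => x; rewrite /thickening /= !dL mulrA.
    by rewrite ltr_pM2r ?invr_gt0.
  by rewrite ltr_pM2r ?invr_gt0.
apply: le_trans (dec y r sy r0 yU L hL _ (mulr_gt0 eta0 dz)) _.
apply: lee_wpmul2r; first exact: measure_ge0.
set s := sup_norm_on _ _ _.
have sz' : ((euclid_dist L z)%:E <= s)%E.
  apply: ereal_sup_ubound; exists z => //=.
  by rewrite ger0_norm// ltW.
have ratio : ((eta * euclid_dist L z)%:E / s <= eta%:E)%E.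
  move: sz'; case: s => [s| |]//.
    rewrite lee_fin => zs; have s0 := lt_le_trans dz zs.
    rewrite inver gt_eqF// -EFinM lee_fin ler_pdivrMr//.
    by rewrite ler_pM2l.
  by move=> _; rewrite invey mule0 lee_fin ltW.
have ratio0 : (0 <= (eta * euclid_dist L z)%:E / s)%E.
  apply: mule_ge0; first by rewrite lee_fin mulr_ge0// ltW.
  by rewrite inve_ge0; apply: le_trans sz'; rewrite lee_fin ltW.
apply: (@le_trans _ _ (C%:E * (eta%:E `^ alpha))%E).
  apply: lee_wpmul2l; first by rewrite lee_fin ltW.
  apply: gt0_ler_poweR => //; rewrite ?ltW// in_itv/= ?andbT leey ?ratio0//.
  by rewrite lee_fin ltW.
rewrite poweR_EFin -EFinM lee_fin.
rewrite -ler_pdivlMl// mulrC.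
apply: (@le_trans _ _ (((delta / C) `^ alpha^-1) `^ alpha)).
  apply: ge0_ler_powR; rewrite ?nnegrE ?powR_ge0//; [exact: ltW|exact: ltW|].
  by rewrite ge_min lexx orbT.
by rewrite -powRrM mulVf ?gt_eqF// powRr1// divr_ge0// ltW.
Qed.

(** Nonplanarity provides m+1 points of the support in the ball whose homogeneous coordinates form
    an invertible matrix; its inverse bounds the coefficients of an affine function by the values at
    these points. *)
Lemma spread_points : 
  (forall L, affine_hyperplane L -> nu L = 0%E) ->
  forall y (r : R), msupport nu y -> 0 < r ->
  exists2 t : R, 0 < t <= 1 & forall (c : 'I_m.+1 -> R) j,
    exists2 x, ball y r x /\ msupport nu x &
      t * `|c j| <= `|\sum_k homog x k ord0 * c k|.
Proof.
move=> nonpl y r sy r0.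
pose S x := ball y r x /\ msupport nu x.
have Sy : S y by split => //; exact: ballxx.
(* Otherwise the support inside the ball would lie in a null hyperplane, although a ball around a
   point of the support has positive measure. *)
have sep (c : 'I_m.+1 -> R) : (exists j, c j != 0) ->
    exists2 x, S x & \sum_k homog x k ord0 * c k != 0.
  move=> [j cj]; apply: contrapT => nx.
  have Hx x : S x -> \sum_k homog x k ord0 * c k = 0.
    by move=> Sx; apply/eqP/negPn/negP => H; apply: nx; exists x.
  pose c' : 'rV[R]_m := \row_l c (lift ord0 l).
  have HS x : S x -> dot c' x = - c ord0.
    move=> /Hx; rewrite sum_homog => /eqP; rewrite addrC addr_eq0 => /eqP <-.
    by apply: eq_bigr => l _; rewrite mxE.
  have [c'0|c'n0] := eqVneq c' 0.
    have c00 : c ord0 = 0.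
      have := HS _ Sy; rewrite /dot c'0 big1 => [/eqP|l _].
        by rewrite eq_sym oppr_eq0 => /eqP.
      by rewrite mxE mul0r.
    move: cj; case: (unliftP ord0 j) => [l ->|->]; last by rewrite c00 eqxx.
    by move/rowP : c'0 => /(_ l); rewrite !mxE => ->; rewrite eqxx.
  pose L := [set x | dot c' x = - c ord0].
  have L0 : nu L = 0%E by apply: nonpl; exists c', (- c ord0).
  have mL : measurable (L : set (borel 'rV[R]_m)).
    apply: borel_closed; apply: (@closed_comp _ _ (dot c') [set x | x = - c ord0]).
      by move=> x _; exact: dot_continuous.
    exact: closed_eq.
  have [N [mN N0 sN]] := negligible_msupportC.
  have := msupport_ball_gt0 sy r0; rewrite ltNge => /negP; apply.
  apply: (@le_trans _ _ (nu (L `|` N))).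
    apply: le_measure; rewrite ?inE; [exact: measurable_ball|exact: measurableU|].
    move=> x yx; have [sx|nsx] := pselect (msupport nu x); last by right; apply: sN.
    by left; apply: HS; split.
  apply: (le_trans (measureU2 _ mL mN)).
  by rewrite [X in (X + _)%E]L0 [X in (_ + X)%E]N0 adde0.
(* Points are added one at a time: a nonzero [v] orthogonal to the rows found so far is separated by
   some new point, which is therefore outside their span. *)
have basis k : (k <= m.+1)%N -> exists2 A : 'M[R]_(k, m.+1), row_free A &
    forall i, exists2 x, S x & row i A = (homog x)^T.
  elim: k => [_|k IH km].
    by exists 0; [rewrite /row_free mxrank.unlock|case].
  have [A fA HA] := IH (ltnW km).
  have : kermx A^T != 0.
    rewrite -mxrank_eq0 mxrank_ker mxrank_tr (eqP fA) subn_eq0 -ltnNge.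
    exact: km.
  move=> /rowV0Pn[v /sub_kermxP vA v0].
  have [|x Sx xv] := sep (fun k => v ord0 k).
    apply: contrapT => nv; move/eqP: v0; apply; apply/rowP => j; rewrite mxE.
    by apply/eqP/negPn/negP => vj; apply: nv; exists j.
  exists (col_mx (homog x)^T A : 'M[R]_(1 + k, m.+1)).
    apply: row_free_col_mx => //; apply/negP => /submxP[w xw]; move/eqP : xv; apply.
    have hx : homog x = A^T *m w^T by rewrite -trmx_mul -xw trmxK.
    have := congr1 (fun M : 'M[R]_(1, 1) => M ord0 ord0) (mulmxA v A^T w^T).
    rewrite vA mul0mx -hx => vx; apply: (@etrans _ _ ((v *m homog x) ord0 ord0)).
      by rewrite [RHS]mxE; apply: eq_bigr => l _; rewrite mulrC.
    by rewrite vx mxE.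
  move=> i; rewrite -(splitK (i : 'I_(1 + k))); case: (fintype.split _) => l /=.
    exists x => //; apply: etrans (rowKu l (homog x)^T A) _.
    by apply/rowP => w; rewrite ord1 mxE.
  by have [z Sz zE] := HA l; exists z => //; apply: etrans (rowKd l _ A) zE.
have [A fA HA] := basis _ (leqnn _).
rewrite row_free_unit in fA.
(* The added 1 makes [M] exceed every absolute row sum of the inverse strictly, so some value must
   have size at least [M^-1] times [c j]. *)
pose M := 1 + \sum_j \sum_k `|invmx A j k|.
have M1 : 1 <= M by rewrite lerDl; apply: sumr_ge0 => j _; exact: sumr_ge0.
have M0 : 0 < M by exact: lt_le_trans M1.
exists M^-1; first by rewrite invr_gt0 M0 invf_le1.
move=> c j; have [->|cj0] := eqVneq (c j) 0.
  by exists y => //; rewrite normr0 mulr0.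
pose C : 'cV[R]_m.+1 := \col_k c k.
have [k Hk] : exists k, M^-1 * `|c j| <= `|(A *m C) k ord0|.
  apply: contrapT => nk.
  have : c j = (invmx A *m (A *m C)) j ord0 by rewrite mulKmx// mxE.
  move=> /(congr1 Num.norm); apply/eqP; rewrite gt_eqF// mxE.
  apply: (le_lt_trans (ler_norm_sum _ _ _)).
  apply: (@le_lt_trans _ _ ((\sum_k `|invmx A j k|) * (M^-1 * `|c j|))).
    rewrite mulr_suml; apply: ler_sum => k _; rewrite normrM ler_wpM2l//.
    by rewrite leNgt; apply/negP => H; apply: nk; exists k; exact: ltW.
  rewrite mulrA gtr_pMl ?normr_gt0// ltr_pdivrMr// mul1r.
  apply: (@le_lt_trans _ _ (\sum_j \sum_k `|invmx A j k|)); last by rewrite ltrDr.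
  by rewrite [leRHS](bigD1 j)//= lerDl sumr_ge0// => l _; exact: sumr_ge0.
have [x Sx xE] := HA k; exists x => //; apply: le_trans Hk _.
have -> : (A *m C) k ord0 = (row k A *m C) ord0 ord0 by rewrite -row_mul [RHS]mxE.
rewrite xE mxE (eq_bigr (fun l => homog x l ord0 * c l))// => l _.
by rewrite !mxE.
Qed.

End Support.

(** * Product measures *)

Section ProductMeasure.
Variables (R : realType) (d m : nat).
Variable mu : {measure set (borel 'M[R]_(d, m)) -> \bar R}.
Variable nu : 'I_d -> {measure set (borel 'rV[R]_m) -> \bar R}.
Hypothesis mu_prod : is_product mu nu.

Lemma le_prode (I : Type) (s : seq I) (f g : I -> \bar R) :
  (forall i, 0 <= f i <= g i)%E -> (\prod_(i <- s) f i <= \prod_(i <- s) g i)%E.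
Proof.
move=> fg; suff : (0 <= \prod_(i <- s) f i <= \prod_(i <- s) g i)%E by case/andP.
elim/big_ind2 : _ => [|a b c e /andP[a0 ab] /andP[c0 ce]|//]; first by rewrite lee01 lexx.
by rewrite mule_ge0//= lee_pmul.
Qed.

Lemma ball_rows (x y : 'M[R]_(d, m)) (r : R) : 0 < r ->
  ball x r y <-> forall i, ball (row i x) r (row i y).
Proof.
move=> r0; split=> [/(mx_ballE _ _ r0) H i|H].
  by apply/(mx_ballE _ _ r0) => k j; rewrite !mxE.
apply/(mx_ballE _ _ r0) => i j.
by have := H i => /(mx_ballE _ _ r0)/(_ ord0 j); rewrite !mxE.
Qed.

Lemma product_ball (x : 'M[R]_(d, m)) (r : R) : 0 < r ->
  mu (ball x r) = (\prod_i nu i (ball (row i x) r))%E.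
Proof.
move=> r0; rewrite -mu_prod; last by move=> i; exact: measurable_ball.
by congr (mu _); apply/seteqP; split => y /(ball_rows _ _ r0).
Qed.

Lemma row_ball_subset (U : 'I_d -> set 'rV[R]_m) (y : 'M[R]_(d, m)) (r : R) i :
  0 < r -> ball y r `<=` [set x | forall k, U k (row k x)] ->
  ball (row i y) r `<=` U i.
Proof.
move=> r0 yU t yt.
pose x : 'M[R]_(d, m) := \matrix_(k, j) if k == i then t ord0 j else y k j.
have xk k : row k x = if k == i then t else row k y.
  by apply/rowP => j; rewrite !mxE; case: eqP => // _; rewrite mxE.
have : ball y r x.
  apply/(ball_rows _ _ r0) => k; rewrite xk; case: eqP => [->//|_].
  exact: ballxx.
by move/yU => /(_ i); rewrite xk eqxx.
Qed.

Lemma measurable_rows (A : 'I_d -> set 'rV[R]_m) :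
  (forall i, measurable (A i : set (borel 'rV[R]_m))) ->
  measurable ([set x | forall i, A i (row i x)] : set (borel 'M[R]_(d, m))).
Proof.
move=> mA.
have mrow i : measurable_fun setT (row i : borel 'M[R]_(d, m) -> borel 'rV[R]_m).
  apply: (@measurability _ _ (borel 'M[R]_(d, m)) (borel 'rV[R]_m) setT (row i)
    (@open 'rV[R]_m)) => // _ [V oV <-].
  rewrite setTI; apply: borel_open; apply: open_comp => // x _.
  move=> W /nbhs_ballP[r /= r0 xW]; apply/nbhs_ballP; exists r => //= y xy.
  by apply: xW; have /(ball_rows _ _ r0) := xy; apply.
rewrite (_ : [set x | _] = \bigcap_(i in [set: 'I_d]) (row i @^-1` A i)).
  apply: fin_bigcap_measurable; first exact: finite_finset.
  by move=> i _; rewrite -[X in measurable X]setTI; exact: mrow.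
by apply/seteqP; split => [x Ax i _|x Ax i]; exact: Ax.
Qed.

(** The cylinder over a null set is a rectangle with one factor of measure 0, and 0 times infinity
    is 0. *)
Lemma negligible_row i (N : set 'rV[R]_m) : (nu i).-negligible N ->
  mu.-negligible [set x | N (row i x)].
Proof.
move=> [M [mM M0 NM]].
pose A k := if k == i then M else setT.
have mA k : measurable (A k : set (borel 'rV[R]_m)).
  by rewrite /A; case: eqP => // _; exact: measurableT.
have HA : mu [set x : 'M[R]_(d, m) | forall k, A k (row k x)] = 0%E.
  by rewrite mu_prod// (bigD1 i)//= /A eqxx [X in (X * _)%E]M0 mul0e.
exists [set x | forall k, A k (row k x)]; split => //; first exact: measurable_rows.
by move=> x /= /NM Mx k; rewrite /A; case: eqP => // ->.
Qed.

Definition prod_support : set 'M[R]_(d, m) :=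
  [set x | forall i, msupport (nu i) (row i x)].

Lemma product_doubling (D : 'I_d -> R) (U : 'I_d -> set 'rV[R]_m) :
  (forall i, radon (nu i)) -> (forall i, 0 < D i) ->
  (forall i, federer (nu i) (D i) (U i)) ->
  forall y (r : R), prod_support y -> 0 < r ->
    ball y (3 * r) `<=` [set x | forall k, U k (row k x)] ->
    (mu (ball y (3 * r)) <= (\prod_i D i)%:E * mu (ball y r))%E.
Proof.
move=> rad D0 fed y r Sy r0 yU; rewrite !product_ball//; last by rewrite mulr_gt0.
rewrite -prodEFin -big_split /=; apply: le_prode => i; rewrite measure_ge0/=.
apply: federer_doubling (fed i) _ _ _ => //; apply: row_ball_subset yU.
by rewrite mulr_gt0.
Qed.

Lemma product_ball_fin_num x (r : R) : (forall i, radon (nu i)) -> 0 < r ->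
  mu (ball x r) \is a fin_num.
Proof.
move=> rad r0; rewrite product_ball//; apply: prode_fin_num => i _.
by rewrite ge0_fin_numE ?measure_ge0// radon_ball_lty.
Qed.

End ProductMeasure.

(** * Rarity of small covolume on a ball *)

Section Good.
Variables (R : realType) (K : fieldExtType rat) (d m : nat).
Variable sigma : 'I_d -> {rmorphism K -> R}.
Variable mu : {measure set (borel 'M[R]_(d, m)) -> \bar R}.
Variable nu : 'I_d -> {measure set (borel 'rV[R]_m) -> \bar R}.
Hypothesis mu_prod : is_product mu nu.
Variables (U : 'I_d -> set 'rV[R]_m) (eta delta : R).
Hypothesis eta_gt0 : 0 < eta.
Hypothesis delta_ge0 : 0 <= delta.
Hypothesis nonconc : forall i y (r : R), msupport (nu i) y -> 0 < r ->
  ball y r `<=` U i ->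
  forall (c0 : R) (c : 'rV[R]_m) z, ball y r z -> msupport (nu i) z ->
    0 < `|c0 + dot c z| ->
    (nu i (ball y r `&` [set x | (`|c0 + dot c x| < eta * `|c0 + dot c z|)%R])
      <= delta%:E * nu i (ball y r))%E.

(** At each place, take the affine minor that realizes the local covolume at [z]. Where the product
    falls below [eta ^+ d * rho], one of these minors has dropped by the factor [eta]; this has
    relative measure at most [delta] for each of the [d] places. *)
Lemma psi_good a b r0 (A : 'M[K]_(r0, m.+1)) (rho : R) y (r : R) : 0 < rho ->
  prod_support nu y -> 0 < r -> ball y r `<=` [set x | forall k, U k (row k x)] ->
  (exists z, [/\ ball y r z, prod_support nu z & rho <= psi sigma a b A z]) ->
  outer_le mu (ball y r `&` [set x | psi sigma a b A x < eta ^+ d * rho])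
    ((d%:R * delta)%:E * mu (ball y r))%E.
Proof.
move=> rho0 Sy rpos yU [z [yz Sz rz]].
pose f i x := covol a b (map_mx (sigma i) A) x.
have fz i : 0 < f i (row i z).
  rewrite lt_neqAle covol_ge0 andbT eq_sym; apply/eqP => fi0.
  move: (lt_le_trans rho0 rz); rewrite /psi (bigD1 i)//=.
  by rewrite [covol _ _ _ _]fi0 mul0r ltxx.
have /choice[g Hg] i : exists g : R * 'rV[R]_m,
    (forall x, `|g.1 + dot g.2 x| <= f i x) /\
    `|g.1 + dot g.2 (row i z)| = f i (row i z).
  have [J JE] := covol_eq_minor (fz i).
  have [c0 [c cE]] := minor_affine a b (map_mx (sigma i) A) J.
  exists (c0, c); split => [x|] /=; rewrite -cE; last by rewrite /f JE.
  exact: minor_le_covol.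
pose bd i : set 'rV[R]_m :=
  ball (row i y) r `&` [set x | `|(g i).1 + dot (g i).2 x| < eta * f i (row i z)].
(* The drop is imposed at place [i] only; the other factors are full balls. *)
pose rect i : set (borel 'M[R]_(d, m)) := [set x | forall k,
  (if k == i then bd i else ball (row k y) r) (row k x)].
have mbd i : measurable (bd i : set (borel 'rV[R]_m)).
  by apply: borel_open; apply: openI; [exact: ball_open|exact: open_affine_lt].
have rectE i : (mu (rect i) <= delta%:E * mu (ball y r))%E.
  rewrite /rect.
  rewrite (mu_prod (A := fun k => if k == i then bd i else ball (row k y) r)); last first.
    by move=> k; case: eqP => // _; exact: measurable_ball.
  rewrite (product_ball mu_prod)// (bigD1 i)//= eqxx.
  rewrite [X in (_ <= _ * X)%E](bigD1 i)//= muleA.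
  rewrite (eq_bigr (fun k => nu k (ball (row k y) r))); last first.
    by move=> k /negbTE ->.
  apply: lee_wpmul2r; first by apply: prode_ge0 => k _; exact: measure_ge0.
  rewrite /bd; have [_ gz] := Hg i; rewrite -gz.
  apply: nonconc => //; first exact: row_ball_subset yU.
  - by have /(ball_rows _ _ rpos) := yz; apply.
  - by rewrite gz.
have mrect i : measurable (rect i).
  apply: (measurable_rows (A := fun k => if k == i then bd i else ball (row k y) r)) => k.
  by case: eqP => // _; exact: measurable_ball.
have -> : ((d%:R * delta)%:E * mu (ball y r) =
    \sum_(i <- index_enum 'I_d) delta%:E * mu (ball y r))%E.
  rewrite -ge0_sume_distrl; last by move=> *; rewrite lee_fin.
  by rewrite sumEFin sumr_const card_ord mulr_natl.
apply: (outer_leW _ (lexx _) (outer_le_bigcup_seq (F := rect) _)); last first.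
  by move=> i _; exists (rect i); split.
move=> x [yx psix]; apply: contrapT => nx.
move: psix; rewrite /= ltNge => /negP; apply.
apply: (@le_trans _ _ (\prod_i (eta * f i (row i z)))).
  rewrite big_split /= prodr_const card_ord; apply: ler_wpM2l => //.
  by rewrite exprn_ge0 ?ltW.
apply: ler_prod => i _; apply/andP; split; first by rewrite mulr_ge0// ltW.
rewrite leNgt; apply/negP => lt.
apply: nx; exists i => [|k]; first exact: mem_index_enum.
rewrite /=; case: eqP => [->|_]; last by have /(ball_rows _ _ rpos) := yx; apply.
split; first by have /(ball_rows _ _ rpos) := yx; apply.
by apply: le_lt_trans lt; have [+ _] := Hg i; apply.
Qed.

End Good.

Section BottomTop.
Variables (R : realType) (K : fieldExtType rat) (d m : nat).
Variable sigma : 'I_d -> {rmorphism K -> R}.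
Hypothesis dimK : \dim {:K} = d.
Hypothesis sigma_inj : forall i j, sigma i =1 sigma j -> i = j.

(** The zero subspace, whose only minor is the empty determinant 1. *)
Lemma lat_bottom : exists L : lat sigma m, lrk L = 0%N /\
  forall a b x, lat_psi a b L x <= 1.
Proof.
have int0 : integral_mx (0 : 'M[K]_(0, m.+1)) by case.
have free0 : row_free (0 : 'M[K]_(0, m.+1)) by rewrite /row_free -leqn0 rank_leq_row.
have min0 (P : 'M[K]_0) : P \in unitmx -> integral_mx (P *m (0 : 'M[K]_(0, m.+1))) ->
    2^-1 <= knorm sigma (\det P).
  move=> _ _; rewrite det_mx00 /knorm big1 => [|i _]; last by rewrite rmorph1 normr1.
  by lra.
exists (Lat int0 free0 min0); split => // a b x.
apply: (@le_trans _ _ (\prod_(i < d) 1)); last by rewrite big1_eq.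
apply: ler_prod => i _; rewrite covol_ge0/=; apply: bigmax_le => // J _.
by rewrite /minor det_mx00 normr1.
Qed.

Lemma lat_top : exists L : lat sigma m, row_full (lmx L).
Proof.
have int1 : integral_mx (1%:M : 'M[K]_m.+1).
  move=> i j; rewrite mxE; case: eqP => _; [exact: ringOfIntegers1|exact: ringOfIntegers0].
have free1 : row_free (1%:M : 'M[K]_m.+1) by rewrite row_free_unit unitmx1.
have [P [uP intP minP]] := exists_minimal dimK sigma_inj int1 free1.
have freeP : row_free (P *m 1%:M) by rewrite mulmx1 row_free_unit.
by exists (Lat intP freeP minP) => /=; rewrite mulmx1 row_full_unit.
Qed.

End BottomTop.

(** * Points with a short vector, for one time of the flow *)

Section Local.
Variables (R : realType) (K : fieldExtType rat) (d m : nat).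
Variable sigma : 'I_d -> {rmorphism K -> R}.
Hypothesis dimK : \dim {:K} = d.
Hypothesis sigma_inj : forall i j, sigma i =1 sigma j -> i = j.
Variable mu : {measure set (borel 'M[R]_(d, m)) -> \bar R}.
Variable nu : 'I_d -> {measure set (borel 'rV[R]_m) -> \bar R}.
Hypothesis mu_prod : is_product mu nu.
Hypothesis nu_radon : forall i, radon (nu i).
Variables (U : 'I_d -> set 'rV[R]_m) (D : 'I_d -> R).
Hypothesis D_gt0 : forall i, 0 < D i.
Hypothesis nu_federer : forall i, federer (nu i) (D i) (U i).

Let UU : set 'M[R]_(d, m) := [set x | forall k, U k (row k x)].
Let C : R := 2 * m.+1%:R ^+ d.

Definition short_vector (a b theta : R) : set 'M[R]_(d, m) :=
  [set x | exists v : 'rV[K]_m.+1, [/\ v != 0, integral_mx v &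
    vnormS sigma a b v x < theta]].

(** Nondivergence for the interval from 0 to the whole space. The summand 1 next to [bad_const] pays
    for the points where the covolume of the whole space is below [eps]. *)
Lemma short_vector_measure (a b rho eps kappa : R) (t : 'I_d -> R) x (r : R) :
  0 <= a -> 0 <= b -> (forall k, (k <= m)%N -> 1 <= a * b ^+ k) ->
  (forall i, 0 < t i <= 1) -> rho = \prod_i t i -> eps <= rho -> 0 <= kappa ->
  (forall i (c : 'I_m.+1 -> R) j,
    exists2 z, ball (row i x) r z /\ msupport (nu i) z &
     t i * `|c j| <= `|\sum_k homog z k ord0 * c k|) ->
  (forall (L : lat sigma m) y (s : R), prod_support nu y -> 0 < s -> ball y s `<=` UU ->
    (exists z, [/\ ball y s z, prod_support nu z & rho <= lat_psi a b L z]) ->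
    outer_le mu (ball y s `&` [set z | lat_psi a b L z < eps])
      (kappa%:E * mu (ball y s))%E) ->
  prod_support nu x -> 0 < r -> ball x (9 ^+ m * 3 * r) `<=` UU ->
  outer_le mu (ball x r `&` prod_support nu `&` short_vector a b (eps / C))
    (((bad_const (\prod_i D i) m + 1) * kappa)%:E * mu (ball x r))%E.
Proof.
move=> a0 b0 ab t01 rhoE eps_rho k0 spread good Sx r0 xU.
have t0 i : 0 <= t i by have /andP[/ltW] := t01 i.
have rho1 : rho <= 1.
  rewrite rhoE; apply: (@le_trans _ _ (\prod_(i < d) 1)); last by rewrite big1_eq.
  apply: ler_prod => i _.
  by have /andP[/ltW -> ->] := t01 i.
have D0 : 0 <= \prod_i D i by apply: prodr_ge0 => i _; exact: ltW.
have C0 : 0 < C by rewrite mulr_gt0// exprn_gt0// ltr0n.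
have big (L : lat sigma m) : (0 < lrk L)%N ->
    exists z, [/\ ball x r z, prod_support nu z & rho <= lat_psi a b L z].
  move=> L0.
  have [z Hz rz] := lat_psi_lower dimK sigma_inj a0 b0 ab t0 spread L0.
  exists z; split; last by rewrite rhoE.
  - by apply/(ball_rows _ _ r0) => i; have [] := Hz i.
  - by move=> i; have [] := Hz i.
have [L0 [rL0 psiL0]] := lat_bottom m sigma.
have [L1 fullL1] := lat_top m dimK sigma_inj.
have rL1 : lrk L1 = m.+1 by rewrite -(eqP (lat_free L1)) (eqP fullL1).
have L01 : lat_lt L0 L1.
  rewrite /lat_lt ltmxErank submx_full// (eqP (lat_free L0)) (eqP (lat_free L1)).
  by rewrite rL0 rL1.
have good1 := good L1 x r Sx r0 _ (big _ _).
have bad01 := @bad_measure R d m mu (prod_support nu) UU (\prod_i D i) D0 _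
  (lat sigma m) ('rV[K]_m.+1) (@lat_lt _ _ _ sigma m) (@lrk _ _ _ sigma m)
  (@lat_mem _ _ _ sigma m) (@lat_psi _ _ _ sigma m a b) (vnormS sigma a b)
  (@lat_lt_trans _ _ _ sigma m) (@lat_lt_rk _ _ _ sigma m)
  (@vnormS_ge0 _ _ _ sigma m a b) C (ltW C0) _
  (@lat_psi_usc _ _ _ sigma m a b) rho eps kappa rho1 eps_rho k0 good
  m L0 L1 x r L01 _ Sx r0 xU _.
have mr : r <= 9 ^+ m * 3 * r.
  have h9 : 1 <= 9 ^+ m :> R by apply: exprn_ege1; lra.
  by nra.
apply: (outer_leW _ _ (outer_leU (bad01 _ _ _ _) (good1 _ _))).
- move=> z [[xz Sz] [v [v0 intv vz]]].
  have [Lz|Lz] := ltP (lat_psi a b L1 z) eps; first by right.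
  left; split => //; split => //; exists v; split.
  - by split => //; exact: submx_full.
  - move=> [_ /submxP[w vw]]; move/eqP: v0; apply; rewrite vw.
    by move: (lmx L0) w {vw}; rewrite rL0 => A w; rewrite thinmx0 mul0mx.
  - by rewrite mulrC -ltr_pdivlMr.
- have b0' := bad_const_ge0 D0 m.
  rewrite -EFinM -ge0_muleDl ?lee_fin ?mulr_ge0// -EFinD.
  by rewrite mulrDl mul1r.
- by apply: (product_doubling mu_prod) => //.
- by move=> L M v; exact: lat_extend.
- by rewrite rL0 rL1.
- move=> L /lat_lt_rk; rewrite rL0 => rL _; exact: big.
- by apply: subset_trans xU; apply: le_ball.
- by rewrite rL1.
Qed.

End Local.

(** * Singular vectors *)

Section Dani.
Variables (R : realType) (K : fieldExtType rat) (d m : nat).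
Variable sigma : 'I_d -> {rmorphism K -> R}.

Lemma mx_norm_coord p q (M : 'M[R]_(p, q)) i j : `|M i j| <= `|M|.
Proof.
rewrite [leRHS]/Num.norm /= mx_normrE.
exact: (le_bigmax _ (fun ij => `|M ij.1 ij.2|) (i, j)).
Qed.

Lemma singular_short_vector (x : 'M[R]_(d, m)) (e : R) : (0 < d)%N -> 0 < e ->
  singular sigma x -> exists N, forall n, (N <= n)%N ->
    short_vector sigma (n.+1%:R ^+ m) n.+1%:R^-1 e x.
Proof.
move=> d0 e0 xsing.
(* Each local norm will be at most [th]; since [th <= 1] and [d] is positive, their product is at
   most [th]. *)
have [th [th0 th1 the]] : exists th : R, [/\ 0 < th, th <= 1 & th < e].
  have m0 : 0 < Num.min 1 e by rewrite lt_min ltr01.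
  have m1 : Num.min 1 e <= 1 by rewrite ge_min lexx.
  have me : Num.min 1 e <= e by rewrite ge_min lexx orbT.
  by exists (Num.min 1 e / 2); split; lra.
(* Singularity is used with c = th^(m+1) and Q = th (n+1), so that c/Q^m = th/(n+1)^m and both
   blocks of coordinates are bounded by [th]. *)
have [M [Mreal HM]] := xsing _ (exprn_gt0 m.+1 th0).
exists (Num.truncn (M / th)) => n Mn.
have n0 : 0 < n.+1%:R :> R by rewrite ltr0n.
have Q0 : M < th * n.+1%:R.
  rewrite mulrC -ltr_pdivrMr//; apply: lt_le_trans (truncnS_gt _) _.
  by rewrite ler_nat.
have [q [q0 [qn0 intq intq0 small bounded]]] := HM _ Q0.
pose v : 'rV[K]_m.+1 := \row_k if unlift ord0 k is Some j then q ord0 j else q0.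
have v0 : v ord0 ord0 = q0 by rewrite mxE unlift_none.
have vS j : v ord0 (lift ord0 j) = q ord0 j by rewrite mxE liftK.
exists v; split.
- apply/eqP => vz; move/eqP: qn0; apply; apply/rowP => j.
  by rewrite -vS vz !mxE.
- move=> i j; rewrite ord1; case: (unliftP ord0 j) => [k ->|->].
    by rewrite vS; exact: intq.
  by rewrite v0.
have vn i : 0 <= vnorm (n.+1%:R ^+ m) n.+1%:R^-1 (map_mx (sigma i) v) (row i x) <= th.
  rewrite vnorm_ge0 /=; apply: bigmax_le => [|j _]; first exact: ltW.
  rewrite mxE; case: (unliftP ord0 j) => [k ->|->].
    rewrite eq_sym (negbTE (neq_lift _ _)) mxE vS normrM ger0_norm ?invr_ge0//.
    rewrite ler_pdivrMl// mulrC.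
    apply: le_trans bounded; apply: le_trans (mx_norm_coord _ i k).
    by rewrite mxE.
  rewrite eqxx normrM ger0_norm ?exprn_ge0//.
  rewrite -ler_pdivlMl ?exprn_gt0//.
  have -> : (map_mx (sigma i) v *m homog (row i x)) ord0 ord0 =
      (dotKS sigma q x + diag_embed sigma (\row_(_ < 1) q0)) i ord0.
    rewrite mxE.
    rewrite (eq_bigr (fun k => homog (row i x) k ord0 * sigma i (v ord0 k))); last first.
      by move=> k _; rewrite mxE mulrC.
    rewrite (sum_homog (fun k => sigma i (v ord0 k))) v0 !mxE addrC; congr (_ + _).
    by apply: eq_bigr => j' _; rewrite vS mxE.
  apply: le_trans (mx_norm_coord _ _ _) _; apply: ltW; apply: lt_le_trans small _.
  rewrite le_eqVlt; apply/orP; left; apply/eqP.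
  rewrite exprS exprMn; field.
  by rewrite !expf_neq0// gt_eqF.
apply: le_lt_trans the; rewrite /vnormS.
apply: (@le_trans _ _ (\prod_(i < d) th)); first exact: ler_prod.
rewrite prodr_const card_ord; case: (d) d0 => // d' _.
by rewrite exprS ler_piMr ?exprn_ile1// ltW.
Qed.

End Dani.

Section SingularLocal.
Variables (R : realType) (K : fieldExtType rat) (d m : nat).
Variable sigma : 'I_d -> {rmorphism K -> R}.
Hypothesis dimK : \dim {:K} = d.
Hypothesis sigma_inj : forall i j, sigma i =1 sigma j -> i = j.
Variable mu : {measure set (borel 'M[R]_(d, m)) -> \bar R}.
Variable nu : 'I_d -> {measure set (borel 'rV[R]_m) -> \bar R}.
Hypothesis mu_prod : is_product mu nu.
Hypothesis nu_radon : forall i, radon (nu i).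
Hypothesis nu_nonplanar : nonplanar nu.

Lemma min_family (I : finType) (f : I -> R) : (forall i, 0 < f i) ->
  exists2 e : R, 0 < e & forall i, e <= f i.
Proof.
move=> f0; exists (\big[Num.min/1]_i f i).
  by apply/bigmin_gtP; split.
by move=> i; exact: bigmin_le.
Qed.

(** The order of choices matters: [r], [t] and [rho] depend on [x] alone, then [delta] on [e], [eta]
    on [delta], and [eps] on [eta] and [rho]. None depends on [n], so the bound survives the passage
    to the limit inferior. *)
Lemma singular_local (x : 'M[R]_(d, m)) : prod_support nu x ->
  (forall i, exists (U : set 'rV[R]_m) (C alpha D : R),
    [/\ open_nbhs (row i x) U, [/\ 0 < C, 0 < alpha & 0 < D],
        federer (nu i) D U & decaying (nu i) C alpha U]) ->
  exists2 r : R, 0 < r &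
    mu.-negligible (ball x r `&` prod_support nu `&` Sing sigma (m := m)).
Proof.
move=> Sx.
move=> /choice[U] /choice[Cf] /choice[alpha] /choice[D] HU.
have D0 i : 0 < D i by have [_ []] := HU i.
have fed i : federer (nu i) (D i) (U i) by have [] := HU i.
pose UU : set 'M[R]_(d, m) := [set x | forall k, U k (row k x)].
have d_gt0 : (0 < d)%N by rewrite -dimK adim_gt0.
have [R0 R0_gt0 xUU] : exists2 R0 : R, 0 < R0 & ball x R0 `<=` UU.
  have /choice[s Hs] i : exists s : R, 0 < s /\ ball (row i x) s `<=` U i.
    have [/open_nbhs_nbhs/nbhs_ballP[s /= s0 sU] _ _ _] := HU i.
    by exists s.
  have [e e0 He] := min_family (fun i => (Hs i).1).
  exists e => // y /(ball_rows _ _ e0) xy i; apply: (Hs i).2.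
  exact: le_ball (He i) _ (xy i).
have h9 : 0 < 9 ^+ m * 3 :> R by rewrite mulr_gt0// exprn_gt0.
pose r := R0 / (9 ^+ m * 3).
have r0 : 0 < r by rewrite divr_gt0.
have rU : ball x (9 ^+ m * 3 * r) `<=` UU by rewrite /r mulrC divfK ?gt_eqF.
exists r => //.
have /choice[t Ht] i : exists t : R, 0 < t <= 1 /\ forall (c : 'I_m.+1 -> R) j,
    exists2 z, ball (row i x) r z /\ msupport (nu i) z &
      t * `|c j| <= `|\sum_k homog z k ord0 * c k|.
  by have [t t01 Ht] := spread_points (nu_nonplanar i) (Sx i) r0; exists t.
pose rho := \prod_i t i.
have rho0 : 0 < rho by apply: prodr_gt0 => i _; have [/andP[]] := Ht i.
have fin := product_ball_fin_num mu_prod x nu_radon r0.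
apply: negligible_outer_le => e e0.
pose b := bad_const (\prod_i D i) m.
have b0 : 0 <= b by apply: bad_const_ge0; apply: prodr_ge0 => i _; exact: ltW.
pose M := fine (mu (ball x r)).
have M0 : 0 <= M by rewrite fine_ge0.
(* The bound becomes e M/(M+1), which is at most [e]. *)
pose delta := e / ((b + 1) * d%:R * (M + 1)).
have den0 : 0 < (b + 1) * d%:R * (M + 1).
  by rewrite !mulr_gt0 ?ltr0n// ltr_wpDl.
have delta0 : 0 < delta by rewrite divr_gt0.
have /choice[eta' Heta] i : exists eta : R, 0 < eta <= 1 /\
    forall y (s : R), msupport (nu i) y -> 0 < s -> ball y s `<=` U i ->
    forall (c0 : R) (c : 'rV[R]_m) z, ball y s z -> msupport (nu i) z ->
    0 < `|c0 + dot c z| ->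
    (nu i (ball y s `&` [set x | (`|c0 + dot c x| < eta * `|c0 + dot c z|)%R])
      <= delta%:E * nu i (ball y s))%E.
  have [_ [Ci ai _] _ deci] := HU i.
  by have [eta eta01 H] := nonconcentration Ci ai deci delta0; exists eta.
have [eta0 eta0_gt0 eta0_le] := min_family (fun i => (andP (Heta i).1).1).
pose eta := Num.min 1 eta0.
have eta_gt0 : 0 < eta by rewrite lt_min ltr01.
have eta_le1 : eta <= 1 by rewrite ge_min lexx.
have nonconc i y (s : R) : msupport (nu i) y -> 0 < s -> ball y s `<=` U i ->
    forall (c0 : R) (c : 'rV[R]_m) z, ball y s z -> msupport (nu i) z ->
    0 < `|c0 + dot c z| ->
    (nu i (ball y s `&` [set x | (`|c0 + dot c x| < eta * `|c0 + dot c z|)%R])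
      <= delta%:E * nu i (ball y s))%E.
  move=> sy s0 yU c0 c z yz sz z0; have [_ H] := Heta i.
  apply: le_trans (H y s sy s0 yU c0 c z yz sz z0).
  have mdot (u : R) : measurable (ball y s `&` [set x | `|c0 + dot c x| < u]
      : set (borel 'rV[R]_m)).
    by apply: borel_open; apply: openI; [exact: ball_open|exact: open_affine_lt].
  apply: le_measure; rewrite ?inE; [exact: mdot|exact: mdot|].
  apply: setIS => w /= /lt_le_trans; apply; rewrite ler_wpM2r//.
  by apply: le_trans (eta0_le i); rewrite ge_min lexx orbT.
pose eps := eta ^+ d * rho.
have eps0 : 0 < eps by rewrite mulr_gt0// exprn_gt0.
have eps_rho : eps <= rho by rewrite ler_piMl ?exprn_ile1// ltW.
pose C : R := 2 * m.+1%:R ^+ d.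
have C0 : 0 < C by rewrite mulr_gt0// exprn_gt0// ltr0n.
have short n : outer_le mu (ball x r `&` prod_support nu `&`
    short_vector sigma (n.+1%:R ^+ m) n.+1%:R^-1 (eps / C)) e%:E.
  have n0 : 0 < n.+1%:R :> R by rewrite ltr0n.
  have := @short_vector_measure R K d m sigma dimK sigma_inj mu nu mu_prod nu_radon
    U D D0 fed (n.+1%:R ^+ m) n.+1%:R^-1 rho eps (d%:R * delta) t x r.
  move=> /(_ (exprn_ge0 _ (ltW n0))).
  have ni0 : 0 <= n.+1%:R^-1 :> R by rewrite invr_ge0.
  move=> /(_ ni0) H.
  have e1 : (((b + 1) * (d%:R * delta))%:E * mu (ball x r) <= e%:E)%E.
    rewrite -(fineK fin) -EFinM lee_fin -/M.
    have -> : (b + 1) * (d%:R * delta) * M = e * (M / (M + 1)).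
      rewrite /delta; field.
      by rewrite !gt_eqF ?ltr0n// ltr_wpDl.
    apply: ler_piMr; first exact: ltW.
    by rewrite ler_pdivrMr ?mul1r ?lerDl// ltr_wpDl.
  refine (outer_leW (@subset_refl _ _) e1 (H _ _ _ _ _ _ _ _ _ _)) => //.
  (* Here a b^k = (n+1)^(m-k). *)
  - move=> k km; rewrite exprVn -{1}(subnK km) exprD mulfK ?expf_neq0 ?gt_eqF//.
    by apply: exprn_ege1; rewrite ler1n.
  - by move=> i; have [] := Ht i.
  - by rewrite mulr_ge0// ltW.
  - by move=> i; have [] := Ht i.
  - by move=> L y s Sy s0 yU HL; exact: (psi_good mu_prod eta_gt0 (ltW delta0) nonconc rho0).
apply: outer_leW (outer_le_liminf short) => // y [[xy Sy] ysing].
have [N HN] := singular_short_vector d_gt0 (divr_gt0 eps0 C0) ysing.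
by exists N => n Nn; split => //; exact: HN.
Qed.

End SingularLocal.

Theorem corollary2p4 (R : realType) (K : fieldExtType rat) (d : nat)
    (dimK : \dim {:K} = d) (realK : totally_real R K)
    (sigma : 'I_d -> {rmorphism K -> R}) (sigmaP : archimedean_places sigma)
    (m : nat) (m_ge1 : (1 <= m)%N)
    (mu : {measure set (borel 'M[R]_(d, m)) -> \bar R})
    (mu_friendly : friendly mu) :
  mu.-negligible (@Sing R K d sigma m).
Proof.
have [nu [nu_radon mu_prod nu_nonplanar nu_ae]] := mu_friendly.
have [sigma_inj _] := sigmaP.
pose good i (x : 'rV[R]_m) := exists (U : set 'rV[R]_m) (C alpha D : R),
  [/\ open_nbhs x U, [/\ 0 < C, 0 < alpha & 0 < D],
      federer (nu i) D U & decaying (nu i) C alpha U].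
pose G := [set x : 'M[R]_(d, m) | prod_support nu x /\ forall i, good i (row i x)].
have negG : mu.-negligible (~` G).
  have [N HN] : exists N : nat -> set 'M[R]_(d, m),
      (forall n, mu.-negligible (N n)) /\ ~` G `<=` \bigcup_n N n.
    (* The finitely many places are indexed by integers, with the empty set beyond [d], to form a
       countable union. *)
    pose N n := if insub n is Some i then [set x : 'M[R]_(d, m) |
      (~ msupport (nu i) (row i x)) \/ ~ good i (row i x)] else set0.
    exists N; split => [n|x].
      rewrite /N; case: insubP => [i _ _|_]; last exact: negligible_set0.
      apply: (negligibleU (negligible_row mu_prod (negligible_msupportC (nu i)))).
      exact: (negligible_row mu_prod (nu_ae i)).
    move=> nGx; apply: contrapT => nx; apply: nGx; split=> i; apply: contrapT => H.
      by apply: nx; exists (i : nat) => //; rewrite /N valK; left.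
    by apply: nx; exists (i : nat) => //; rewrite /N valK; right.
  by case: HN => HN sub; apply: (negligibleS (mu := mu) sub); exact: negligible_bigcup.
(* The complement of [G] being null, countably many of the balls given by [singular_local] cover
   what remains. *)
pose E := G `&` Sing sigma (m := m).
have negE : mu.-negligible E.
  have [->|/set0P E0] := eqVneq E set0; first exact: negligible_set0.
  have /choice[r Hr] x : exists r : R, E x -> 0 < r /\
      mu.-negligible (ball x r `&` prod_support nu `&` Sing sigma (m := m)).
    have [[[Sx gx] _]|nE] := pselect (E x); last by exists 0 => /nE.
    have [r r0 H] := singular_local dimK sigma_inj mu_prod nu_radon nu_nonplanar Sx gx.
    by exists r.
  have [y [yE Ey]] := lindelof_balls E0 (fun x Ex => (Hr x Ex).1).
  apply: (@negligibleS _ _ _ mu (\bigcup_n (ball (y n) (r (y n)) `&` prod_support nu `&`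
      Sing sigma (m := m)))).
    by move=> x Ex; have [n _ nx] := Ey x Ex; exists n => //; case: Ex => -[].
  by apply: negligible_bigcup => n; exact: (Hr _ (yE n)).2.
apply: (negligibleS (mu := mu) _ (negligibleU negG negE)) => x Sx.
by have [Gx|nGx] := pselect (G x); [right|left].
Qed.
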